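(* Let $\mathcal H_1,\mathcal H_2,\mathcal D_S,\mathcal D_2,\mathcal D_{-S},\mathcal D_{-1},\mathcal D_{-2}$ be complex Hilbert spaces and $A,B,C,D_0,D$ operators satisfying assumptions (a)--(c) of the context, and let $\Theta\subset\mathbb C$, the operator matrix $\mathcal A_0$ in $\mathcal H_1\oplus\mathcal H_2$ and the operator family $S_0(\lambda)$, $\lambda\in\Theta$, in $\mathcal H_1$ be as in the context. (i) The following inclusion holds: $$\sigma(S_0(\cdot))\cap\rho(D_0)\subset\sigma(\mathcal A_0)\cap\rho(D_0)\cap\Theta.$$ (ii) Let $C_0:=C|_{\operatorname{dom}C_0}$, $\operatorname{dom}C_0:=\{f\in\mathcal D_S:Cf\in\mathcal H_2\}$ (regarded as an operator from $\mathcal H_1$ to $\mathcal H_2$). If $\Sigma\subset\Theta$ is such that for all $\lambda\in\Sigma$ one has $S_0(\lambda)\in\mathcal C(\mathcal H_1)$ and, in addition, either $\operatorname{coker}(D_0-\lambda)=\{0\}$, or $D_0-\lambda\in\mathcal F_-(\mathcal H_2)$ with $\operatorname{coker}(D_0-\lambda)\subset\operatorname{dom}C_0^*$ and $\operatorname{dom}C_0$ dense in $\mathcal D_S$, then $$\sigma_{\mathrm{e2}}(S_0(\cdot))\cap\Sigma\subset\sigma_{\mathrm{e2}}(\mathcal A_0)\cap\Sigma.$$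
   Context: Notation. $\mathcal B(\mathcal G_1,\mathcal G_2)$ is the space of everywhere defined bounded linear operators between Hilbert spaces; $\mathcal C(\mathcal G)$ is the set of closed (not necessarily densely defined) linear operators in $\mathcal G$; $\rho,\sigma$ denote resolvent set and spectrum. For a linear operator $T$ in $\mathcal G$, $\operatorname{coker}T:=(\operatorname{ran}T)^\perp$. $\mathcal F_+(\mathcal G)=\{T\in\mathcal C(\mathcal G):\operatorname{ran}T\text{ closed},\dim\ker T<\infty\}$, $\mathcal F_-(\mathcal G)=\{T\in\mathcal C(\mathcal G):\operatorname{ran}T\text{ closed},\dim\operatorname{coker}T<\infty\}$, $\sigma_{\mathrm{e2}}(T)=\{\lambda\in\mathbb C:T-\lambda\notin\mathcal F_+(\mathcal G)\}$. For $T\in\mathcal C(\mathcal G)$ with closed range, the generalised inverse $T^\#\in\mathcal B(\mathcal G)$ is defined by $T^\#x=(T|_{\operatorname{dom}T\cap(\ker T)^\perp})^{-1}x$ for $x\in\operatorname{ran}T$ and $T^\#x=0$ for $x\in\operatorname{coker}T$. $T_1\subset T_2$ means $T_2$ extends $T_1$. Assumptions. (a) $\mathcal D_S\subset\mathcal H_1\subset\mathcal D_{-S}$ and $\mathcal D_2\subset\mathcal H_2\subset\mathcal D_{-2}$, where all these canonical embeddings are continuous with dense range; moreover $\mathcal D_{-S}\subset\mathcal D_{-1}$ is continuously embedded. (b) $A\in\mathcal B(\mathcal D_S,\mathcal D_{-1})$, $B\in\mathcal B(\mathcal D_2,\mathcal D_{-1})$, $C\in\mathcal B(\mathcal D_S,\mathcal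 D_{-2})$. (c) $D_0\in\mathcal C(\mathcal H_2)$, $\operatorname{dom}D_0\subset\mathcal D_2$ is dense in $\mathcal D_2$, and there is an extension $D_0\subset D\in\mathcal B(\mathcal D_2,\mathcal D_{-2})$. Definitions. With $\mathcal D:=\mathcal D_S\oplus\mathcal D_2$, $\mathcal D_-:=\mathcal D_{-1}\oplus\mathcal D_{-2}$, $\mathcal H:=\mathcal H_1\oplus\mathcal H_2$, put $\mathcal A:=\begin{pmatrix}A&B\\C&D\end{pmatrix}\in\mathcal B(\mathcal D,\mathcal D_-)$ and $\mathcal A_0:=\mathcal A|_{\operatorname{dom}\mathcal A_0}$, $\operatorname{dom}\mathcal A_0:=\{(f,g)\in\mathcal D:\mathcal A(f,g)\in\mathcal H\}$, an operator in $\mathcal H$. $\Theta\subset\mathbb C$ is a set such that for every $\lambda\in\Theta$ the range of $D_0-\lambda$ is closed in $\mathcal H_2$ and there exists an extension $(D_0-\lambda)^\#\subset D^\ddagger(\lambda)\in\mathcal B(\mathcal D_{-2},\mathcal D_2)$ (fixed for each $\lambda$). For $\lambda\in\Theta$, $$S(\lambda):=A-\lambda-BD^\ddagger(\lambda)C\in\mathcal B(\mathcal D_S,\mathcal D_{-1}),$$ $S_0(\lambda):=S(\lambda)|_{\operatorname{dom}S_0(\lambda)}$, $\operatorname{dom}S_0(\lambda):=\{f\in\mathcal D_S:S(\lambda)f\in\mathcal H_1\}$, an operator in $\mathcal H_1$. For the family, $\sigma(S_0(\cdot)):=\{\lambda\in\Theta:0\in\sigma(S_0(\lambda))\}$ and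 $\sigma_{\mathrm{e2}}(S_0(\cdot)):=\{\lambda\in\Theta:0\in\sigma_{\mathrm{e2}}(S_0(\lambda))\}$. *)

(* Defs.v *)
From HB Require Import structures.
From mathcomp Require Import all_boot all_order all_algebra.
From mathcomp Require Import sesquilinear.
From mathcomp Require Import all_classical all_reals topology normedtype.
From mathcomp Require Import ring.
From mathcomp Require Export complex.

Set Implicit Arguments.
Unset Strict Implicit.
Unset Printing Implicit Defensive.

Import Order.TTheory GRing.Theory Num.Theory.
Import numFieldNormedType.Exports.

Local Open Scope classical_set_scope.
Local Open Scope ring_scope.

HB.mixin Record CompleteNormedModule_isHilbert (K : numClosedFieldType) V
    & CompleteNormedModule K V := {
  hdot : {dot V for (@Num.conj K)} ;
  hdotE : forall x : V, `|x| ^+ 2 = hdot x x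
}.

#[short(type="hilbertType")]
HB.structure Definition Hilbert (K : numClosedFieldType) :=
  {V of CompleteNormedModule K V & CompleteNormedModule_isHilbert K V}.

Arguments hdot {K s} : rename.

(** The orthogonal direct sum: [V * W] with the norm
    [sqrt (|x|^2 + |y|^2)] instead of the library's max norm. *)
Definition hsum (V W : Type) : Type := (V * W)%type.

Section HilbertSum.
Context {K : numClosedFieldType} {V W : hilbertType K}.
Local Notation VW := (hsum V W).

HB.instance Definition _ := GRing.Lmodule.copy VW (V * W)%type.

Let nrm (z : VW) : K := sqrtC (`|z.1| ^+ 2 + `|z.2| ^+ 2).

Let nrm_sq z : nrm z ^+ 2 = `|z.1| ^+ 2 + `|z.2| ^+ 2.
Proof. exact: sqrtCK. Qed.

Let nrm_ge0 z : 0 <= nrm z.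
Proof. by rewrite sqrtC_ge0 addr_ge0 ?exprn_ge0. Qed.

Let nrmD x y : nrm (x + y) <= nrm x + nrm y.
Proof.
have lem (a b c d : K) : 0 <= a -> 0 <= b -> 0 <= c -> 0 <= d ->
    (a + c) ^+ 2 + (b + d) ^+ 2 <=
    (sqrtC (a ^+ 2 + b ^+ 2) + sqrtC (c ^+ 2 + d ^+ 2)) ^+ 2.
  move=> a0 b0 c0 d0; rewrite [leRHS]sqrrD !sqrtCK.
  rewrite [leLHS](_ : _ = (a ^+ 2 + b ^+ 2) + (a * c + b * d) *+ 2
                          + (c ^+ 2 + d ^+ 2)); last by ring.
  rewrite lerD2r lerD2l lerMn2r/=.
  rewrite -(@ler_pXn2r _ 2) ?nnegrE ?addr_ge0 ?mulr_ge0 ?sqrtC_ge0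
          ?addr_ge0 ?exprn_ge0//.
  rewrite exprMn !sqrtCK -subr_ge0.
  rewrite [X in 0 <= X](_ : _ = (a * d - b * c) ^+ 2); last by ring.
  by rewrite real_exprn_even_ge0// rpredB// rpredM// ger0_real.
rewrite -(@ler_pXn2r _ 2) ?nnegrE ?addr_ge0//.
rewrite nrm_sq (le_trans _ (lem _ _ _ _ _ _ _ _))// lerD// ler_pXn2r ?nnegrE
        ?addr_ge0//; exact: ler_normD.
Qed.

Let nrmZ (l : K) x : nrm (l *: x) = `|l| * nrm x.
Proof.
apply: (@pexpIrn _ 2); rewrite ?nnegrE ?mulr_ge0//.
by rewrite exprMn !nrm_sq !normrZ !exprMn mulrDr.
Qed.

Let nrm0_eq0 x : nrm x = 0 -> x = 0.
Proof.
move=> x0; have := nrm_sq x; rewrite x0 expr0n/= => /esym/eqP.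
rewrite paddr_eq0 ?exprn_ge0// !expf_eq0/= !normr_eq0.
by case: x {x0} => x y /= /andP[/eqP-> /eqP->].
Qed.

HB.instance Definition _ :=
  Lmodule_isNormed.Build K VW nrmD nrmZ nrm0_eq0.

Lemma hsum_normE (z : VW) : `|z| = sqrtC (`|z.1| ^+ 2 + `|z.2| ^+ 2).
Proof. by []. Qed.

Lemma hsum_norm_sq (z : VW) : `|z| ^+ 2 = `|z.1| ^+ 2 + `|z.2| ^+ 2.
Proof. exact: nrm_sq. Qed.

Lemma hsum_norm_ge1 (z : VW) : `|z.1| <= `|z|.
Proof.
by rewrite -(@ler_pXn2r _ 2) ?nnegrE// hsum_norm_sq lerDl exprn_ge0.
Qed.

Lemma hsum_norm_ge2 (z : VW) : `|z.2| <= `|z|.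
Proof.
by rewrite -(@ler_pXn2r _ 2) ?nnegrE// hsum_norm_sq lerDr exprn_ge0.
Qed.

Lemma hsum_norm_le (z : VW) : `|z| <= `|z.1| + `|z.2|.
Proof.
rewrite -(@ler_pXn2r _ 2) ?nnegrE ?addr_ge0// hsum_norm_sq sqrrD.
by rewrite addrAC lerDl mulrn_wge0 ?mulr_ge0.
Qed.

Let hsum_complete (F : set_system VW) :
  ProperFilter F -> cauchy F -> cvg F.
Proof.
move=> FF /cauchyP Fc.
have c1 : cvg (fst @ F).
  apply: cauchy_cvg; apply/cauchyP => e e0.
  have [z Fz] := Fc e e0; exists z.1.
  suff sub : ball z e `<=` fst @^-1` ball z.1 e by exact: filterS sub Fz.
  move=> w; rewrite /preimage /= -!ball_normE /=; apply: le_lt_trans.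
  exact: (hsum_norm_ge1 (z - w)).
have c2 : cvg (snd @ F).
  apply: cauchy_cvg; apply/cauchyP => e e0.
  have [z Fz] := Fc e e0; exists z.2.
  suff sub : ball z e `<=` snd @^-1` ball z.2 e by exact: filterS sub Fz.
  move=> w; rewrite /preimage /= -!ball_normE /=; apply: le_lt_trans.
  exact: (hsum_norm_ge2 (z - w)).
move/cvg_ex : c1 => [x Fx]; move/cvg_ex : c2 => [y Fy].
apply/cvg_ex; exists ((x, y) : VW); apply/(@cvgrPdist_lt _ VW _ _ _ id) => e e0.
have e20 : 0 < e / 2 by rewrite divr_gt0.
move/cvgrPdist_lt : Fx => /(_ _ e20) Fx; move/cvgrPdist_lt : Fy => /(_ _ e20) Fy.
apply: filterS2 Fx Fy => w wx wy.
apply: le_lt_trans (hsum_norm_le _) _.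
by rewrite [e]splitr ltrD.
Qed.

HB.instance Definition _ := Uniform_isComplete.Build VW hsum_complete.

Definition hsum_dot (z w : VW) : K := hdot z.1 w.1 + hdot z.2 w.2.

Let hsum_dot_bilinear : bilinear_for
  (GRing.Scale.Law.clone _ _ ( *%R ) _)
  (GRing.Scale.Law.clone _ _ (@Num.conj K \; *%R ) _) hsum_dot.
Proof.
split=> [w|w] a x y; rewrite /hsum_dot /=.
  by rewrite !linearPl /= mulrDr addrACA.
by rewrite !linearPr /= mulrDr addrACA.
Qed.

HB.instance Definition _ :=
  bilinear_isBilinear.Build K VW VW K _ _ hsum_dot hsum_dot_bilinear.

Let hsum_dot_hermitian x y :
  hsum_dot x y = (-1) ^+ false * Num.conj (hsum_dot y x).
Proof. by rewrite /hsum_dot rmorphD mulrDr -!hermC. Qed.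

HB.instance Definition _ :=
  isHermitianSesquilinear.Build K VW false (@Num.conj K) hsum_dot hsum_dot_hermitian.

Let hsum_dot_gt0 u : u != 0 -> 0 < hsum_dot u u.
Proof.
by rewrite /hsum_dot -!hdotE -hsum_norm_sq => u0; rewrite exprn_gt0// normr_gt0.
Qed.

HB.instance Definition _ := isDotProduct.Build K VW hsum_dot hsum_dot_gt0.

Let hsum_dotE (x : VW) : `|x| ^+ 2 = hsum_dot x x.
Proof. by rewrite hsum_norm_sq !hdotE. Qed.

HB.instance Definition _ :=
  CompleteNormedModule_isHilbert.Build K VW hsum_dotE.

Lemma hsum_hdotE (z w : VW) : hdot z w = hdot z.1 w.1 + hdot z.2 w.2.
Proof. by []. Qed.

End HilbertSum.

Lemma pair_ext (S T : Type) (p q : S * T) : p.1 = q.1 -> p.2 = q.2 -> p = q.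
Proof. by case: p q => [? ?] [? ?] /= -> ->. Qed.

(** A linear operator is given by its graph, a single-valued linear subspace
    of [G1 * G2]; its domain need not be dense, nor its graph closed. *)
Record linop (K : numClosedFieldType) (G1 G2 : lmodType K) := Linop {
  op_graph :> set (G1 * G2) ;
  op_graph0 : op_graph 0 ;
  op_graphP : forall (a : K) u v, op_graph u -> op_graph v -> op_graph (a *: u + v) ;
  op_graph_fun : forall x y y', op_graph (x, y) -> op_graph (x, y') -> y = y'
}.

Definition op_dom {G1 G2 : Type} (T : set (G1 * G2)) : set G1 :=
  [set x | exists y, T (x, y)].

Definition op_ran {G1 G2 : Type} (T : set (G1 * G2)) : set G2 :=
  [set y | exists x, T (x, y)].

Definition op_ker {K : numClosedFieldType} {G1 G2 : lmodType K}
    (T : set (G1 * G2)) : set G1 := [set x | T (x, 0)].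

(** [op_shift T l] is [T - l]. *)
Section Shift.
Context {K : numClosedFieldType} {G : lmodType K} (T : linop G G) (l : K).

Definition shift_graph : set (G * G) := [set p | op_graph T (p.1, p.2 + l *: p.1)].

Fact shift_graph0 : shift_graph 0.
Proof. by rewrite /shift_graph /= scaler0 addr0; exact: op_graph0. Qed.

Fact shift_graphP (a : K) u v :
  shift_graph u -> shift_graph v -> shift_graph (a *: u + v).
Proof.
case: u v => [x y] [x' y'] /= Tu Tv; rewrite /shift_graph /=.
suff -> : (a *: x + x', a *: y + y' + l *: (a *: x + x')) =
  a *: (x, y + l *: x) + (x', y' + l *: x') by exact: op_graphP.
apply: pair_ext => //=.
by rewrite !scalerDr !scalerA mulrC addrACA.
Qed.

Fact shift_graph_fun x y y' :
  shift_graph (x, y) -> shift_graph (x, y') -> y = y'.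
Proof. by move=> /op_graph_fun /[apply] /addIr. Qed.

Definition op_shift : linop G G :=
  Linop shift_graph0 shift_graphP shift_graph_fun.
End Shift.

Section OperatorTheory.
Context {K : numClosedFieldType}.

Definition closed_op {G1 G2 : hilbertType K} (T : linop G1 G2) : Prop :=
  closed (T : set (G1 * G2)).

(** No closedness of [T] is presupposed: as a bounded everywhere defined
    operator has a closed graph, the resolvent set of a non-closed operator
    is empty, and its spectrum is the whole of [K]. *)
Definition resolvent {G : hilbertType K} (T : linop G G) : set K :=
  [set l | exists2 R : {linear G -> G}, continuous R &
           forall x y, op_graph (op_shift T l) (x, y) <-> x = R y].

Definition spectrum {G : hilbertType K} (T : linop G G) : set K :=
  ~` resolvent T.

Definition fin_dim {G : lmodType K} (A : set G) : Prop :=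
  exists (n : nat) (e : 'I_n -> G),
    A = [set \sum_(i < n) c i *: e i | c in [set: 'I_n -> K]].

Definition ortho_compl {G : hilbertType K} (A : set G) : set G :=
  [set x | forall y, A y -> hdot x y = 0].

Definition op_coker {G1 G2 : hilbertType K} (T : set (G1 * G2)) : set G2 :=
  ortho_compl (op_ran T).

Definition Fplus {G : hilbertType K} (T : linop G G) : Prop :=
  [/\ closed_op T, closed (op_ran T) & fin_dim (op_ker T)].

Definition Fminus {G : hilbertType K} (T : linop G G) : Prop :=
  [/\ closed_op T, closed (op_ran T) & fin_dim (op_coker T)].

Definition sigma_e2 {G : hilbertType K} (T : linop G G) : set K :=
  [set l | ~ Fplus (op_shift T l)].

(** The graph of [T^#]: [(u + v, y)] with [u] in [op_ran T], [v] in
    [op_coker T] and [y] the element of [op_dom T] orthogonal to [op_ker T]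
    with [T y = u]. Its domain is the whole space when [op_ran T] is closed. *)
Definition gen_inverse {G : hilbertType K} (T : linop G G) : set (G * G) :=
  [set p | exists u v, [/\ p.1 = u + v, op_coker T v,
                           ortho_compl (op_ker T) p.2 & op_graph T (p.2, u)]].

(** The graph of [T^*], which is single-valued when [op_dom T] is dense. *)
Definition adjoint {G1 G2 : hilbertType K} (T : linop G1 G2) :
    set (G2 * G1) :=
  [set p | forall x y, op_graph T (x, y) -> hdot y p.1 = hdot x p.2].

Record embedding (U V : hilbertType K) := Embedding {
  emb :> {linear U -> V} ;
  emb_continuous : continuous emb ;
  emb_inj : injective emb
}.

Section CompEmbedding.
Context {U V W : hilbertType K} (f : embedding V W) (g : embedding U V).

Definition emb_comp_fun : {linear U -> W} := f \o g.

Fact emb_comp_continuous : continuous emb_comp_fun.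
Proof.
move=> x; apply: (@continuous_comp U V W g f).
  exact: emb_continuous.
exact: emb_continuous.
Qed.

Fact emb_comp_inj : injective emb_comp_fun.
Proof. by move=> x y /emb_inj /emb_inj. Qed.

Definition emb_comp : embedding U W :=
  Embedding emb_comp_continuous emb_comp_inj.
End CompEmbedding.

Section SumEmbedding.
Context {U1 U2 V1 V2 : hilbertType K}.
Context (f1 : embedding U1 V1) (f2 : embedding U2 V2).

Definition sum_fun (z : hsum U1 U2) : hsum V1 V2 := (f1 z.1, f2 z.2).

Fact sum_fun_linear : linear sum_fun.
Proof. by move=> a x y; rewrite /sum_fun /= !linearP. Qed.

HB.instance Definition _ :=
  GRing.isLinear.Build K (hsum U1 U2) (hsum V1 V2) _ sum_fun sum_fun_linear.

Fact sum_fun_continuous : continuous sum_fun.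
Proof.
have /linear_bounded_continuous/linear_boundedP b1 := @emb_continuous _ _ f1.
have /linear_bounded_continuous/linear_boundedP b2 := @emb_continuous _ _ f2.
move: b1 b2 => /pinfty_ex_gt0[r1 r10 b1] /pinfty_ex_gt0[r2 r20 b2].
apply/linear_bounded_continuous/ex_bound; exists (r1 + r2).
apply/(@nbhs_norm0P K (hsum U1 U2)); exists 1 => //= z /ltW z1.
apply: le_trans (hsum_norm_le _) _; apply: lerD.
  apply: le_trans (b1 _) _; rewrite -[leRHS]mulr1 ler_pM2l//.
  exact: le_trans (hsum_norm_ge1 z) z1.
apply: le_trans (b2 _) _; rewrite -[leRHS]mulr1 ler_pM2l//.
exact: le_trans (hsum_norm_ge2 z) z1.
Qed.

Fact sum_fun_inj : injective sum_fun.
Proof. by move=> [x y] [x' y'] [] /emb_inj -> /emb_inj ->. Qed.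

Definition emb_sum : embedding (hsum U1 U2) (hsum V1 V2) :=
  Embedding sum_fun_continuous sum_fun_inj.
End SumEmbedding.

(** Given [U] embedded in [G1] by [i], [G2] embedded in [E] by [j], and
    [T : U -> E], the restriction of [T] to those [x] in [U] with [T x] in
    [G2], as an operator from [G1] to [G2]. *)
Section Part.
Context {U G1 G2 E : hilbertType K}.
Context (i : embedding U G1) (j : embedding G2 E) (T : {linear U -> E}).

Definition part_graph : set (G1 * G2) :=
  [set p | exists2 x, p.1 = i x & T x = j p.2].

Fact part_graph0 : part_graph 0.
Proof. by exists 0; rewrite ?linear0. Qed.

Fact part_graphP (a : K) u v :
  part_graph u -> part_graph v -> part_graph (a *: u + v).
Proof.
move=> [x ux Tx] [y vy Ty]; exists (a *: x + y).
  by rewrite /= ux vy linearP.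
by rewrite linearP Tx Ty -linearP.
Qed.

Fact part_graph_fun x y y' :
  part_graph (x, y) -> part_graph (x, y') -> y = y'.
Proof.
move=> [u /= -> Tu] [v /= /emb_inj uv Tv]; apply: (@emb_inj _ _ j).
by rewrite -Tu uv.
Qed.

Definition part_op : linop G1 G2 :=
  Linop part_graph0 part_graphP part_graph_fun.
End Part.

Section BlockOperator.
Context {U1 U2 V1 V2 : hilbertType K}.
Context (A : {linear U1 -> V1}) (B : {linear U2 -> V1}).
Context (C : {linear U1 -> V2}) (D : {linear U2 -> V2}).

Definition block_op (z : hsum U1 U2) : hsum V1 V2 :=
  (A z.1 + B z.2, C z.1 + D z.2).

Fact block_op_linear : linear block_op.
Proof.
move=> a x y; rewrite /block_op /= !linearP.
by apply: pair_ext; rewrite /= scalerDr addrACA.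
Qed.

HB.instance Definition _ :=
  GRing.isLinear.Build K (hsum U1 U2) (hsum V1 V2) _ block_op block_op_linear.
End BlockOperator.

Definition family_spectrum {G : hilbertType K} (Theta : set K)
    (T : K -> linop G G) : set K := [set l | Theta l /\ spectrum (T l) 0].

Definition family_sigma_e2 {G : hilbertType K} (Theta : set K)
    (T : K -> linop G G) : set K := [set l | Theta l /\ sigma_e2 (T l) 0].

(** In [A - l - B D' C] the scalar [l] acts through the embedding [e]. *)
Definition schur_complement {DS D2 Dm1 Dm2 : hilbertType K}
    (e : embedding DS Dm1) (A : {linear DS -> Dm1}) (B : {linear D2 -> Dm1})
    (C : {linear DS -> Dm2}) (D' : {linear Dm2 -> D2}) (l : K) :
    {linear DS -> Dm1} :=
  A \- l \*: e \- (B \o D' \o C).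

End OperatorTheory.

(* Main.v *)
(* Write [T = D0 - l] and let [V] be its cokernel.  For [f] in [dom S0] the vector
   [(f, - D' C f)] lies in [dom A0] and [A0 - l] maps it to [(S0 f, K f)], where
   [j2 K f = C f - (D - l) D' C f].  If [V = 0] then [K = 0].  Otherwise, on the
   dense set [dom C0], [K f] is the projection of [C0 f] onto [V], so
   [V <= dom C0^*] makes [K] a finite-rank operator that is bounded in the norm
   of [H1].

   (i) If [l] is in [rho (D0)], [D'] is a two-sided inverse of [D - l], and the
   upper left corner of [(A0 - l)^-1] is an inverse of [S0].

   (ii) [ker S0] intersected with [ker K] embeds in [ker (A0 - l)].  For the
   range, the subspace [G0] of those pairs [((f, g), (h, k))] in the graph of
   [A0 - l] which satisfy [S0 f = h] and [k = K f] is closed, and so is its sum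
   with the finite-dimensional space [ker (A0 - l) x 0].  By the open mapping theorem the
   range [{(S0 f, K f)}] of the sum is closed; adding [0 x V] to it gives
   [ran S0 x V], so that [ran S0] is closed. *)
From HB Require Import structures.
Require Import Defs.
From mathcomp Require Import all_boot all_order all_algebra.
From mathcomp Require Import all_classical all_reals topology normedtype.
From mathcomp Require Import sesquilinear ring lra.
Import Order.TTheory GRing.Theory Num.Theory.
Import numFieldNormedType.Exports.
Local Open Scope classical_set_scope.
Local Open Scope ring_scope.

(** * Real-valued norms and geometric sequences *)

Section RealNorm.
Context {R : realType}.
Implicit Types V W : normedModType R[i].

(* Norms of complex normed modules live in the partially ordered [R[i]];
   [rnorm] is the same norm with values in [R]. *)
Definition rnorm {V} (x : V) : R := complex.Re `|x|.

Lemma normE V (x : V) : `|x| = (rnorm x)%:C%C.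
Proof. by rewrite RRe_real// normr_real. Qed.

Lemma rnorm_ge0 V (x : V) : 0 <= rnorm x.
Proof. by rewrite -ler0c -normE. Qed.

Lemma rnormD V (x y : V) : rnorm (x + y) <= rnorm x + rnorm y.
Proof. by have := ler_normD x y; rewrite !normE -rmorphD lecR. Qed.

Lemma rnormN V (x : V) : rnorm (- x) = rnorm x.
Proof. by rewrite /rnorm normrN. Qed.

Lemma rnormB V (x y : V) : rnorm (x - y) = rnorm (y - x).
Proof. by rewrite -rnormN opprB. Qed.

Lemma rnorm_tri V (z x y : V) : rnorm (x - y) <= rnorm (x - z) + rnorm (z - y).
Proof. by rewrite -{1}(subrK z x) -addrA rnormD. Qed.

Lemma rnorm0 V : rnorm (0 : V) = 0.
Proof. by rewrite /rnorm normr0. Qed.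

Lemma rnormZ V (a : R[i]) (x : V) : rnorm (a *: x) = complex.Re `|a| * rnorm x.
Proof.
have /(congr1 (@complex.Re R)) := normrZ a x.
by rewrite !normE -(RRe_real (normr_real a)) -rmorphM.
Qed.

Lemma rnormZC V (a : R) (x : V) : rnorm (a%:C%C *: x) = `|a| * rnorm x.
Proof. by rewrite rnormZ /= expr0n /= addr0 sqrtr_sqr. Qed.

Lemma rnorm_eq0 V (x : V) : rnorm x = 0 -> x = 0.
Proof. by move=> x0; apply/normr0_eq0; rewrite normE x0. Qed.

Lemma rnorm_gt0 V (x : V) : x != 0 -> 0 < rnorm x.
Proof. by move=> x0; rewrite -ltcR -normE normr_gt0. Qed.

Lemma gt0_complex (e : R[i]) : 0 < e -> exists2 r : R, 0 < r & e = r%:C%C.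
Proof.
move=> e0; exists (complex.Re e); last by rewrite RRe_real// gtr0_real.
by rewrite -ltcR RRe_real// gtr0_real.
Qed.

Lemma ball_rnormP V (x y : V) (e : R) :
  ball x e%:C%C y <-> rnorm (x - y) < e.
Proof. by rewrite -ball_normE /ball_ /= normE ltcR. Qed.

Lemma closed_rnormP V (A : set V) :
  closed A <->
  forall x, (forall e : R, 0 < e -> exists2 y, A y & rnorm (x - y) < e) -> A x.
Proof.
split=> [cA x Ax|cA x Ax].
  apply: cA => B /nbhs_ballP[e /= /gt0_complex[r r0 ->]] xB.
  have [y Ay xy] := Ax _ r0; exists y; split => //.
  by apply: xB; apply/ball_rnormP.
apply: cA => e e0.
have [|y [Ay /ball_rnormP xy]] := Ax (ball x e%:C%C).
  by apply: nbhsx_ballx; rewrite ltcR.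
by exists y.
Qed.

(** Balls of [V * W] are products of balls, so the two coordinates may be approximated
    separately. *)
Lemma closed_graphP V W (A : set (V * W)) :
  closed A <->
  forall x y, (forall e : R, 0 < e -> exists x' y',
     [/\ A (x', y'), rnorm (x - x') < e & rnorm (y - y') < e]) -> A (x, y).
Proof.
split=> [cA x y Ax|cA [x y] Ax].
  apply: cA => B /nbhs_ballP[e /= /gt0_complex[r r0 ->]] xB.
  have [x' [y' [Ay xx' yy']]] := Ax _ r0; exists (x', y'); split => //.
  by apply: xB; split; apply/ball_rnormP.
apply: cA => e e0.
have [|[x' y'] [Ay [/ball_rnormP xy /ball_rnormP xy']]] := Ax (ball (x, y) e%:C%C).
  by apply: nbhsx_ballx; rewrite ltcR.
by exists x', y'.
Qed.

Lemma dense_rnorm V (A : set V) : dense A ->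
  forall x (e : R), 0 < e -> exists2 y, A y & rnorm (x - y) < e.
Proof.
move=> dA x e e0; have [||y [/ball_rnormP xy Ay]] := dA (ball x e%:C%C).
- by exists x; apply: ballxx; rewrite ltcR.
- by apply: ball_open; rewrite ltcR.
by exists y.
Qed.

Lemma continuous_rnormP V W (f : {linear V -> W}) :
  continuous f <-> exists2 M, 0 < M & forall x, rnorm (f x) <= M * rnorm x.
Proof.
split=> [/linear_bounded_continuous/linear_boundedP/pinfty_ex_gt0|].
  move=> [_ /gt0_complex[r r0 ->] fr]; exists r => // x.
  by rewrite -lecR rmorphM /= -[X in X <= _]normE -[X in _ * X]normE.
move=> [r r0 fr]; apply/linear_bounded_continuous/linear_boundedP.
exists r%:C%C; split=> [|s rs x]; first by rewrite complex_real.
rewrite (le_trans _ (ler_wpM2r (normr_ge0 x) (ltW rs)))//.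
by rewrite !normE -rmorphM lecR.
Qed.

Lemma small_mul (M e : R) : 0 <= M -> 0 < e -> exists2 d, 0 < d & M * d < e.
Proof.
move=> M0 e0; exists (e / (M + 1)); first by rewrite divr_gt0// ltr_wpDl.
by rewrite mulrCA gtr_pMr// ltr_pdivrMr; lra.
Qed.

Lemma eq_from_rnorm V (x y : V) :
  (forall e : R, 0 < e -> rnorm (x - y) <= e) -> x = y.
Proof.
move=> xy; apply/subr0_eq/rnorm_eq0/le_anti; rewrite rnorm_ge0 andbT.
by apply/ler_addgt0Pr => e e0; rewrite add0r xy.
Qed.

Lemma half_expn_small (M e : R) : 0 < e -> exists n, M * 2^-1 ^+ n < e.
Proof.
move=> e0; exists (Num.truncn (`|M| / e)).+1.
rewrite exprVn ltr_pdivrMr ?exprn_gt0// mulrC -ltr_pdivrMr//.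
apply: (@le_lt_trans _ _ (`|M| / e)); first by rewrite ler_pM2r ?invr_gt0// ler_norm.
apply: lt_le_trans (truncnS_gt _) _.
by rewrite -natrX ler_nat ltnW// ltn_expl.
Qed.

Lemma half_expnS n : 2^-1 ^+ n.+1 = 2^-1 * 2^-1 ^+ n :> R.
Proof. exact: exprS. Qed.

Lemma half_expn_gt0 n : 0 < 2^-1 ^+ n :> R.
Proof. by rewrite exprn_gt0// invr_gt0. Qed.

(** The increments from index [n] on sum to at most [2 * M * 2^-1 ^+ n]. This explicit rate serves
    the minimising sequence of [projection], the nested balls of [baire_cover] and the iteration of
    [closed_range_lift]. *)
Lemma geometric_cvg (V : completeNormedModType R[i]) (u : nat -> V) (M : R) :
  (forall n, rnorm (u n.+1 - u n) <= M * 2^-1 ^+ n) ->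
  exists l, forall n, rnorm (l - u n) <= 2 * M * 2^-1 ^+ n.
Proof.
move=> uM.
have M0 : 0 <= M.
  by have := le_trans (rnorm_ge0 _ _) (uM 0%N); rewrite expr0 mulr1.
have uu n k : rnorm (u (n + k)%N - u n) <= 2 * M * 2^-1 ^+ n.
  (* The exact partial geometric sum is what the induction on [k] can carry. *)
  suff : rnorm (u (n + k)%N - u n) <= 2 * M * (2^-1 ^+ n - 2^-1 ^+ (n + k)).
    move=> /le_trans; apply; rewrite ler_wpM2l ?mulr_ge0//.
    by rewrite gerBl ltW// half_expn_gt0.
  elim: k => [|k IH]; first by rewrite addn0 !subrr rnorm0 mulr0.
  apply: le_trans (rnorm_tri _ (u (n + k)%N) _ _) _.
  rewrite addnS; have := uM (n + k)%N; rewrite half_expnS; lra.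
have cu : cauchy (u @ \oo).
  apply/cauchyP => e /gt0_complex[r r0 ->].
  have [n nr] := half_expn_small (2 * M) r r0.
  exists (u n); exists n => // m /= nm; apply/ball_rnormP.
  by rewrite rnormB -(subnKC nm); apply: le_lt_trans (uu _ _) nr.
have /cvg_ex[l ul] : cvg (u @ \oo) by exact: cauchy_cvg.
exists l => n; apply/ler_addgt0Pr => e e0.
have e0C : 0 < e%:C%C by rewrite ltcR.
have /= [m _ um] := ul _ (nbhsx_ballx l _ e0C).
have /ball_rnormP lm := um (n + m)%N (leq_addl n m).
apply: le_trans (rnorm_tri _ (u (n + m)%N) _ _) _.
by rewrite addrC lerD// ltW.
Qed.
End RealNorm.

(** * Orthogonal projection *)

Section Hilbert.
Context {R : realType}.
Implicit Types V W : hilbertType R[i].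

Definition linear_subspace {V : lmodType R[i]} (A : set V) : Prop :=
  A 0 /\ forall a u v, A u -> A v -> A (a *: u + v).

Lemma linear_subspaceD {V : lmodType R[i]} (A : set V) u v :
  linear_subspace A -> A u -> A v -> A (u + v).
Proof. by move=> [_ AP] Au Av; rewrite -[u]scale1r; exact: AP. Qed.

Lemma linear_subspaceZ {V : lmodType R[i]} (A : set V) a u :
  linear_subspace A -> A u -> A (a *: u).
Proof. by move=> [A0 AP] Au; rewrite -[_ *: _]addr0; exact: AP. Qed.

Lemma linear_subspaceB {V : lmodType R[i]} (A : set V) u v :
  linear_subspace A -> A u -> A v -> A (u - v).
Proof.
move=> sA Au Av; rewrite -scaleN1r.
by apply: linear_subspaceD => //; exact: linear_subspaceZ.
Qed.

Lemma hdot_rnorm V (x : V) : hdot x x = (rnorm x ^+ 2)%:C%C.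
Proof. by rewrite -hdotE normE rmorphXn. Qed.

Lemma hdotC V (x y : V) : hdot x y = Num.conj (hdot y x).
Proof. by rewrite hermC expr0 mul1r. Qed.

Lemma hdot_eq0C V (x y : V) : hdot x y = 0 -> hdot y x = 0.
Proof. by rewrite [hdot y x]hdotC => ->; rewrite conjC0. Qed.

Lemma hdotDl V (x y z : V) : hdot (x + y) z = hdot x z + hdot y z.
Proof. exact: linearDl. Qed.

Lemma hdotBl V (x y z : V) : hdot (x - y) z = hdot x z - hdot y z.
Proof. exact: linearBl. Qed.

Lemma hdotZl V a (x z : V) : hdot (a *: x) z = a * hdot x z.
Proof. exact: linearZl_LR. Qed.

Lemma hdot0l V (z : V) : hdot 0 z = 0.
Proof. exact: linear0l. Qed.

Lemma hdot0r V (z : V) : hdot z 0 = 0.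
Proof. exact: linear0r. Qed.

Lemma hdot_self_eq0 V (x : V) : hdot x x = 0 -> x = 0.
Proof.
rewrite -hdotE => /eqP; rewrite expf_eq0 /= => /eqP; exact: normr0_eq0.
Qed.

Lemma pythagoras V (x y : V) : hdot x y = 0 ->
  rnorm (x + y) ^+ 2 = rnorm x ^+ 2 + rnorm y ^+ 2.
Proof. by move=> xy; apply: complexI; rewrite rmorphD /= -!hdot_rnorm hnormDd. Qed.

Lemma parallelogram V (x y : V) :
  rnorm (x + y) ^+ 2 + rnorm (x - y) ^+ 2 = 2 * (rnorm x ^+ 2 + rnorm y ^+ 2).
Proof.
apply: complexI; rewrite rmorphM !rmorphD /= -!hdot_rnorm hnormD hnormB.
by rewrite rmorph1; ring.
Qed.

(** The coefficient is that of the projection of [x] onto the line of [y]. For [y = 0] the quotient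
    is multiplied by zero, so no case distinction is passed on to the users. *)
Lemma hdot_residue V (x y : V) a :
  hdot (x - (hdot x y / hdot y y) *: y) (a *: y) = 0.
Proof.
rewrite hdotC hdotZl rmorphM /= -hdotC.
have [->|y0] := eqVneq y 0; first by rewrite hdot0r mulr0.
rewrite hdotBl hdotZl divfK ?subrr ?mulr0//.
by apply: contra_neq y0 => /hdot_self_eq0.
Qed.

Lemma pythagoras_residue V (x y : V) :
  rnorm x ^+ 2 = rnorm (x - (hdot x y / hdot y y) *: y) ^+ 2 +
                 rnorm ((hdot x y / hdot y y) *: y) ^+ 2.
Proof. by rewrite -pythagoras ?hdot_residue// subrK. Qed.

Lemma rnorm_residue V (x y : V) :
  rnorm (x - (hdot x y / hdot y y) *: y) <= rnorm x.
Proof.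
rewrite -ler_sqr ?nnegrE ?rnorm_ge0// [leRHS](pythagoras_residue _ x y).
by rewrite lerDl sqr_ge0.
Qed.

(** The projection of [x] onto the line of [y] is no longer than [x]. *)
Lemma cauchy_schwarz V (x y : V) :
  complex.Re `|hdot x y| <= rnorm x * rnorm y.
Proof.
have [->|y0] := eqVneq y 0; first by rewrite hdot0r normr0 rnorm0 mulr0.
set t := hdot x y / hdot y y.
have -> : hdot x y = t * hdot y y.
  by rewrite divfK//; apply: contra_neq y0 => /hdot_self_eq0.
have -> : `|t * hdot y y| = `|t| * (rnorm y ^+ 2)%:C%C.
  by rewrite normrM -hdotE normrX normr_id (normE _ y) rmorphXn.
rewrite -(RRe_real (normr_real t)) -rmorphM /= mulrA ler_wpM2r ?rnorm_ge0//.
rewrite -rnormZ -ler_sqr ?nnegrE ?rnorm_ge0// [leRHS](pythagoras_residue _ x y).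
by rewrite lerDr sqr_ge0.
Qed.

(** A minimising sequence for the distance from [x] to [A] converges by the parallelogram law, and
    its limit [l] lies in [A] by closedness. Minimality at [l] forces orthogonality. *)
Lemma projection V (A : set V) : linear_subspace A -> closed A ->
  forall x, exists2 p, A p & forall y, A y -> hdot (x - p) y = 0.
Proof.
move=> sA /closed_rnormP cA x.
pose E := [set rnorm (x - a) ^+ 2 | a in A]; pose d := inf E.
have hE : has_inf E.
  split; first by exists (rnorm (x - 0) ^+ 2), 0 => //; case: sA.
  by exists 0 => _ [a _ <-]; exact: sqr_ge0.
have dE a : A a -> d <= rnorm (x - a) ^+ 2.
  by move=> Aa; apply: ge_inf; [case: hE | exists a].
have d0 : 0 <= d by apply: lb_le_inf; [case: hE | move=> _ [a _ <-]; exact: sqr_ge0].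
(* With this excess over the infimum, the parallelogram law at the midpoint of two consecutive terms
   bounds their distance by [2 * 2^-1 ^+ n]. *)
have ex n : exists a, A a /\ rnorm (x - a) ^+ 2 < d + (2^-1 ^+ n) ^+ 2.
  have [|_ [a Aa <-] ad] := @inf_adherent _ _ ((2^-1 ^+ n) ^+ 2) _ hE.
    by rewrite exprn_gt0// half_expn_gt0.
  by exists a.
have [a Aa] := choice ex.
have h0 n := @half_expn_gt0 R n.
have two_half : (2%:R : R)%:C%C * (2^-1 : R)%:C%C = 1 :> R[i].
  by rewrite -rmorphM /= divff// pnatr_eq0.
have [|l la] := @geometric_cvg _ _ a 2.
  move=> n; rewrite -ler_sqr ?nnegrE ?rnorm_ge0 ?mulr_ge0 ?ltW//.
  have [An an] := Aa n; have [An1 an1] := Aa n.+1.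
  have := parallelogram _ (x - a n) (x - a n.+1).
  have -> : x - a n - (x - a n.+1) = a n.+1 - a n.
    by rewrite opprB addrC addrA subrK.
  have -> : x - a n + (x - a n.+1) =
      (2%:R : R)%:C%C *: (x - (2^-1 : R)%:C%C *: (a n + a n.+1)).
    rewrite scalerBr scalerA two_half scale1r addrACA -opprD.
    by rewrite rmorph_nat scaler_nat mulr2n.
  have /dE : A ((2^-1 : R)%:C%C *: (a n + a n.+1)).
    by apply: linear_subspaceZ => //; apply: linear_subspaceD.
  rewrite rnormZC normr_nat exprMn.
  move: an1; rewrite half_expnS exprMn; move: (h0 n) an.
  have := sqr_ge0 (2^-1 ^+ n : R).
  set z := rnorm (x - _) ^+ 2; rewrite exprMn; lra.
have Al : A l.
  apply: cA => e e0; have [n ne] := half_expn_small (2 * 2) e e0.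
  by exists (a n); [case: (Aa n) | apply: le_lt_trans (la n) _].
exists l => // y Ay.
have ld : rnorm (x - l) ^+ 2 <= d.
  apply/ler_addgt0Pr => e e0.
  (* With [h = 2^-1 ^+ n <= 1], [v ^+ 2 < d + h ^+ 2] and [v <= d + 1], the square of [v + 4 * h]
     exceeds [d] by at most [(17 + 8 * (d + 1)) * h]. *)
  have [n ne] := half_expn_small (17 + 8 * (d + 1)) e e0.
  have [_ an] := Aa n.
  have h1 : 2^-1 ^+ n <= 1 :> R by rewrite exprn_ile1//; lra.
  have := rnorm_tri _ (a n) x l; rewrite [rnorm (a n - l)]rnormB.
  move: (h0 n) (la n) (rnorm_ge0 _ (x - a n)) (rnorm_ge0 _ (x - l)) an ne h1.
  set h := _ ^+ n; set u := rnorm _; set v := rnorm (x - a n); set w := rnorm _.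
  move=> hp uh v0 w0 vd hh h1 wv.
  have v1 : v <= d + 1 by nra.
  have : w ^+ 2 <= (v + 4 * h) ^+ 2 by rewrite ler_sqr ?nnegrE//; lra.
  nra.
(* Moving from [l] to [l + t *: y] would lower the squared distance by the squared norm of [t *: y],
   which must therefore vanish. *)
pose t := hdot (x - l) y / hdot y y.
have := pythagoras_residue _ (x - l) y; rewrite -/t.
have /dE : A (l + t *: y) by rewrite addrC; case: sA => _; exact.
rewrite opprD addrA => dt eq.
have ty0 : t *: y = 0.
  apply: rnorm_eq0; apply/eqP; rewrite -sqrf_eq0; apply/eqP/le_anti.
  rewrite sqr_ge0 andbT; lra.
by have := hdot_residue _ (x - l) y 1; rewrite -/t ty0 subr0 scale1r.
Qed.
End Hilbert.

(** * Finite-dimensional subspaces *)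

Section Span.
Context {K : numClosedFieldType}.
Implicit Type V : lmodType K.

(** This is the sum of [A] and the span of [s]. Adding one vector at a time suits induction on [s]
    and asks for no linear independence. *)
Fixpoint add_span {V} (A : set V) (s : seq V) : set V :=
  if s is v :: s' then [set x | exists c, add_span A s' (x - c *: v)] else A.

Definition linspan {V} : seq V -> set V := add_span [set 0].

Lemma linspan_cons V (v : V) s x :
  linspan (v :: s) x = (exists c, linspan s (x - c *: v)).
Proof. by []. Qed.

Lemma fin_dimP V (A : set V) : fin_dim A <-> exists s, A = linspan s.
Proof.
split=> [[n [e ->]]|[s ->]].
  elim: n e => [|n IH] e.
    exists [::]; apply/seteqP; split=> [_ [c _ <-]|_ ->].
      by rewrite big_ord0.
    by exists (fun=> 0) => //; rewrite big_ord0.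
  have [s ss] := IH (fun i => e (lift ord0 i)).
  exists (e ord0 :: s); apply/seteqP; split=> [_ [c _ <-]|x].
    rewrite linspan_cons; exists (c ord0); rewrite -ss big_ord_recl addrC addKr.
    by exists (fun i => c (lift ord0 i)).
  rewrite linspan_cons -ss => -[c [d _ dx]].
  exists (fun i => oapp d c (unlift ord0 i)) => //.
  rewrite big_ord_recl unlift_none /=; under eq_bigr do rewrite liftK.
  by rewrite dx addrC subrK.
elim: s => [|v s [n [e se]]].
  exists 0%N, (fun=> 0); apply/seteqP; split=> [_ ->|_ [c _ <-]].
    by exists (fun=> 0) => //; rewrite big_ord0.
  by rewrite big_ord0.
exists n.+1, (fun i => oapp e v (unlift ord0 i)).
apply/seteqP; split=> [x|_ [c _ <-]]; rewrite linspan_cons se.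
  move=> -[c [d _ dx]].
  exists (fun i => oapp d c (unlift ord0 i)) => //.
  rewrite big_ord_recl unlift_none /=; under eq_bigr do rewrite liftK.
  by rewrite dx addrC subrK.
exists (c ord0); rewrite big_ord_recl unlift_none addrC addKr.
by under eq_bigr do rewrite liftK; exists (fun i => c (lift ord0 i)).
Qed.
End Span.

(** * Finite-dimensional extensions of subspaces *)

Section HilbertSpan.
Context {R : realType}.

Lemma add_span_linear_subspace (V : lmodType R[i]) (A : set V) s :
  linear_subspace A -> linear_subspace (add_span A s).
Proof.
move=> sA; elim: s => //= v s [s0 sP]; split=> [|a x y [c xc] [d yd]].
  by exists 0; rewrite scale0r subr0.
exists (a * c + d); rewrite scalerDl opprD addrACA -scalerA -scalerBr.
exact: sP.
Qed.

Lemma sub_add_span (V : lmodType R[i]) (A : set V) s :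
  A `<=` add_span A s.
Proof.
by elim: s => //= v s IH x /IH; exists 0; rewrite scale0r subr0.
Qed.

Lemma add_spanP (V : lmodType R[i]) (A : set V) s x :
  add_span A s x <-> exists2 y, linspan s y & A (x - y).
Proof.
elim: s x => [|v s IH] x /=.
  split=> [Ax|[_ ->]]; last by rewrite subr0.
  by exists 0; rewrite ?subr0.
split=> [[c /IH[y sy xy]]|[y [c sy] xy]].
  exists (y + c *: v); first by exists c; rewrite addrK.
  by rewrite opprD addrA addrAC.
exists c; apply/IH; exists (y - c *: v) => //.
by rewrite opprB addrA subrK.
Qed.

Lemma linear_subspace0 (V : lmodType R[i]) : linear_subspace [set (0 : V)].
Proof. by split=> // a _ _ -> ->; rewrite scaler0 addr0. Qed.

Lemma linspan_linear_subspace (V : lmodType R[i]) (s : seq V) :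
  linear_subspace (linspan s).
Proof. exact/add_span_linear_subspace/linear_subspace0. Qed.

(** Elimination of one generator: an [x] in [A] outside [linspan s] has a nonzero coefficient [c] at
    [v], and subtracting multiples of [x] brings every element of [A] into [linspan s], where the
    induction hypothesis applies. *)
Lemma linear_subspace_in_linspan (V : lmodType R[i]) (A : set V) s :
  linear_subspace A -> A `<=` linspan s -> fin_dim A.
Proof.
move=> sA As; apply/fin_dimP; elim: s A sA As => [|v s IH] A sA As.
  exists [::]; apply/seteqP; split=> // x ->; case: sA => //.
have sAs : linear_subspace (A `&` linspan s).
  have [s0 sP] := linspan_linear_subspace _ s; case: sA => A0 AP.
  by split=> // a x y [Ax sx] [Ay sy]; split; [exact: AP|exact: sP].
have [t At] := IH _ sAs (@subIsetr _ _ _).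
have [[x Ax sx]|nx] := pselect (exists2 x, A x & ~ linspan s x); last first.
  exists t; rewrite -At; apply/esym/setIidPl => x Ax.
  by apply: contrapT => sx; apply: nx; exists x.
have [c xc] := As x Ax; rewrite -/(linspan s) in xc.
have c0 : c != 0 by apply: contra_notN sx => /eqP c0; rewrite c0 scale0r subr0 in xc.
exists (x :: t); apply/seteqP; split=> [y Ay|y]; rewrite linspan_cons -At.
  have [d yd] := As y Ay; rewrite -/(linspan s) in yd.
  exists (d / c); split.
    by apply: linear_subspaceB => //; exact: linear_subspaceZ.
  have -> : y - d / c *: x = y - d *: v - (d / c) *: (x - c *: v).
    by rewrite scalerBr scalerA divfK// opprB addrA subrK.
  apply: linear_subspaceB (linspan_linear_subspace _ s) yd _.
  exact: linear_subspaceZ (linspan_linear_subspace _ s) xc.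
move=> [d [Ayx _]]; rewrite -[y](subrK (d *: x)).
by apply: linear_subspaceD => //; exact: linear_subspaceZ.
Qed.

Context {V : hilbertType R[i]}.

(** Each functional lowers the dimension by at most one: if [hdot x w] is nonzero, then [x] and the
    part of [A] orthogonal to [w] together span [A]. *)
Lemma linspan_of_forms (A : set V) (ws s : seq V) : linear_subspace A ->
  (forall x, A x -> (forall w, w \in ws -> hdot x w = 0) -> linspan s x) ->
  exists t, A `<=` linspan t.
Proof.
elim: ws A => [|w ws IH] A sA As.
  by exists s => x Ax; apply: As.
have [[x Ax xw]|nx] := pselect (exists2 x, A x & hdot x w <> 0); last first.
  apply: IH => // x Ax xws; apply: As => // u.
  rewrite in_cons => /orP[/eqP->|]; last exact: xws.
  by apply: contrapT => xw; apply: nx; exists x.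
have [||t At] := IH (A `&` [set x | hdot x w = 0]).
- split=> [|a y z [Ay yw] [Az zw]].
    by split; [case: sA | exact: hdot0l].
  split; first by case: sA => _; exact.
  by rewrite /= hdotDl hdotZl yw zw mulr0 addr0.
- move=> y [Ay yw] yws; apply: As => // u.
  by rewrite in_cons => /orP[/eqP->//|]; exact: yws.
exists (x :: t) => y Ay; exists (hdot y w / hdot x w).
apply: At; split.
  by apply: linear_subspaceB => //; exact: linear_subspaceZ.
by rewrite /= hdotBl hdotZl divfK ?subrr//; apply/eqP.
Qed.

Lemma closed_set0 : closed [set (0 : V)].
Proof.
apply/closed_rnormP => x xe /=; apply: eq_from_rnorm => e e0.
by have [_ -> /ltW] := xe e e0.
Qed.

(** The new vector [v] can be replaced by its component [w] orthogonal to the closed space built so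
    far. Membership is then tested on the residue of [x] along [w], which does not increase
    distances. *)
Lemma closed_add_span (A : set V) s :
  linear_subspace A -> closed A -> closed (add_span A s).
Proof.
move=> sA cA; elim: s => //= v s cs.
have ss := add_span_linear_subspace _ _ s sA.
have [p sp vp] := projection _ _ ss cs v.
pose w := v - p.
(* Orthogonality of [w] to the smaller space forces the coefficient; if [w = 0], every coefficient
   will do. *)
have addP x : (exists c, add_span A s (x - c *: v)) <->
    add_span A s (x - (hdot x w / hdot w w) *: w).
  split=> [[c xc]|xw]; last first.
    exists (hdot x w / hdot w w).
    rewrite -[x - _](_ : x - (hdot x w / hdot w w) *: w -
        (hdot x w / hdot w w) *: p = _).
      by apply: linear_subspaceB => //; exact: linear_subspaceZ.
    by rewrite -addrA -opprD -scalerDr subrK.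
  have xcw : add_span A s (x - c *: w).
    rewrite /w scalerBr opprB addrA addrAC.
    by apply: linear_subspaceD => //; exact: linear_subspaceZ.
  have [w0|w0] := eqVneq w 0; first by rewrite w0 !scaler0 in xcw *.
  suff -> : hdot x w / hdot w w = c by [].
  have ww : hdot w w != 0 by apply: contra_neq w0; exact: hdot_self_eq0.
  rewrite -[x](subrK (c *: w)) hdotDl hdotZl (hdot_eq0C _ _ _ (vp _ xcw)) add0r.
  by rewrite mulfK.
apply/closed_rnormP => x xe; apply/addP.
move/closed_rnormP : cs; apply => e e0.
have [y /addP yw xy] := xe e e0.
exists (y - (hdot y w / hdot w w) *: w) => //.
apply: le_lt_trans xy; rewrite opprB.
rewrite [X in rnorm X](_ : _ = x - y - (hdot (x - y) w / hdot w w) *: w).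
  exact: rnorm_residue.
by rewrite (hdotBl _ x) mulrBl scalerBl opprB addrACA [RHS]addrACA [- y - _]addrC.
Qed.


Lemma closed_linspan (s : seq V) : closed (linspan s).
Proof.
by apply: closed_add_span closed_set0; exact: linear_subspace0.
Qed.

(* Gram-Schmidt in the form of a reproducing formula. *)
Lemma dual_family (s : seq V) : exists2 l : seq (V * V),
  (forall p, p \in l -> linspan s p.1 /\ linspan s p.2) &
  forall x, linspan s x -> x = \sum_(p <- l) hdot x p.2 *: p.1.
Proof.
elim: s => [|v s [l ls lx]].
  by exists [::] => // x ->; rewrite big_nil.
have ss := linspan_linear_subspace _ s.
have sv x : linspan s x -> linspan (v :: s) x.
  by move=> sx; exists 0; rewrite scale0r subr0.
have [p sp vp] := projection _ _ ss (closed_linspan s) v.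
pose w := v - p.
have sw : linspan (v :: s) w.
  exists 1; rewrite scale1r /w addrC addrA addNr add0r -scaleN1r.
  exact: linear_subspaceZ.
exists (((hdot w w)^-1 *: w, w) :: l).
  move=> q; rewrite in_cons => /orP[/eqP->|/ls[q1 q2]] /=; last by split; exact: sv.
  split=> //; apply: linear_subspaceZ sw; exact: linspan_linear_subspace.
move=> x [c xc].
have y_s : linspan s (x - c *: w).
  rewrite /w scalerBr opprB addrA addrAC.
  by apply: linear_subspaceD => //; exact: linear_subspaceZ.
rewrite big_cons /= scalerA.
(* The old family reproduces [x - c *: w], and its functionals do not see [c *: w] because [w] is
   orthogonal to [linspan s]. *)
have -> : \sum_(q <- l) hdot x q.2 *: q.1 = x - c *: w.
  rewrite [RHS]lx// !big_seq; apply: eq_bigr => q /ls[_ q2].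
  by rewrite hdotBl hdotZl vp// mulr0 subr0.
rewrite -[in hdot x w](subrK (c *: w) x) hdotDl hdotZl.
rewrite (hdot_eq0C _ _ _ (vp _ y_s)) add0r.
have [->|w0] := eqVneq w 0; first by rewrite !scaler0 subr0 add0r.
have ww : hdot w w != 0 by apply: contra_neq w0; exact: hdot_self_eq0.
by rewrite (mulfK ww) addrC subrK.
Qed.
End HilbertSpan.

(** * Open mapping theorem for closed operators *)

Section OpenMapping.
Context {R : realType}.

(* The form of Baire's theorem used for the open mapping theorem; the library
   has Baire's theorem for real scalars only. *)
Lemma baire_cover (V : completeNormedModType R[i]) (A : nat -> set V) :
  (forall y, exists n, A n y) ->
  exists n y0 r, 0 < r /\ forall y, rnorm (y - y0) < r ->
    forall e, 0 < e -> exists2 a, A n a & rnorm (y - a) < e.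
Proof.
move=> Acover; apply: contrapT => nA.
(* If no [A n] is dense in a ball, any ball contains a point whose distance to [A n] is at least
   twice a suitable new radius. The value [(c, r)] is a dummy for a nonpositive radius. *)
have step (p : nat * (V * R)) : exists q : V * R, 0 < p.2.2 ->
    [/\ 0 < q.2, q.2 <= p.2.2 / 2, rnorm (q.1 - p.2.1) <= p.2.2 / 2 &
        forall a, A p.1 a -> 2 * q.2 <= rnorm (q.1 - a)].
  case: p => n [c r] /=; have [r0|r0] := boolP (0 < r); last by exists (c, r).
  apply: contrapT => nq; apply: nA; exists n, c, (r / 2); split=> [|y yc e e0].
    by rewrite divr_gt0.
  apply: contrapT => na; apply: nq; exists (y, Num.min (r / 2) (e / 2)) => _ /=.
  split; [by rewrite lt_min !divr_gt0 | by rewrite ge_min lexx | exact: ltW |].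
  move=> a Aa.
  have : e <= rnorm (y - a).
    by rewrite leNgt; apply/negP => ya; apply: na; exists a.
  have : Num.min (r / 2) (e / 2) <= e / 2 by rewrite ge_min lexx orbT.
  lra.
have [f fP] := choice step.
pose st := fix st n := if n is n'.+1 then f (n', st n') else (0 : V, 1 : R).
pose c n := (st n).1; pose r n := (st n).2.
have r0 n : 0 < r n by elim: n => [|n IH]; [exact: ltr01 | case: (fP (n, st n))].
have stP n := fP (n, st n) (r0 n).
have rS n : r n.+1 <= r n / 2 by case: (stP n).
have cS n : rnorm (c n.+1 - c n) <= r n / 2 by case: (stP n).
have rn n : r n <= 2^-1 ^+ n.
  elim: n => [|n IH]; first by rewrite expr0.
  have := rS n; rewrite half_expnS; lra.
have [|l lc] := geometric_cvg _ c 1.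
  by move=> n; rewrite mul1r; have := cS n; have := rn n; have := r0 n; lra.
have cc n k : rnorm (c (n + k)%N - c n) <= r n - r (n + k)%N.
  elim: k => [|k IH]; first by rewrite addn0 !subrr rnorm0.
  rewrite addnS; have := rnorm_tri _ (c (n + k)%N) (c (n + k).+1) (c n).
  have := cS (n + k)%N; have := rS (n + k)%N; lra.
have lr n : rnorm (l - c n) <= r n.
  apply/ler_addgt0Pr => e e0; have [k ke] := half_expn_small (2 * 1) e e0.
  have := rnorm_tri _ (c (n + k)%N) l (c n); have := cc n k; have := r0 (n + k)%N.
  have := lc (n + k)%N.
  have : 2 * 1 * 2^-1 ^+ (n + k) <= 2 * 1 * 2^-1 ^+ k :> R.
    rewrite exprD ler_pM2l; last by lra.
    by rewrite ler_piMl ?(ltW (half_expn_gt0 _))// exprn_ile1//; lra.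
  lra.
(* The limit is within [r n.+1] of [c n.+1], while all of [A n] stays at distance at least
   [2 * r n.+1]. *)
have [n Al] := Acover l.
have [_ _ _ /(_ l Al)] := stP n.
have := lr n.+1; have := r0 n.+1; rewrite [rnorm (c n.+1 - l)]rnormB.
rewrite /r /c /=; lra.
Qed.

Section LinOp.
Context {X Y : lmodType R[i]} (T : linop X Y).

Lemma linopB x y x' y' : op_graph T (x, y) -> op_graph T (x', y') ->
  op_graph T (x - x', y - y').
Proof.
move=> Txy Txy'.
have -> : (x - x', y - y') = -1 *: (x', y') + (x, y).
  by apply: pair_ext => /=; rewrite scaleN1r addrC.
exact: op_graphP.
Qed.

Lemma linopZ a x y : op_graph T (x, y) -> op_graph T (a *: x, a *: y).
Proof.
move=> Txy.
have -> : (a *: x, a *: y) = a *: (x, y) + 0 by rewrite addr0.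
exact: op_graphP Txy (op_graph0 T).
Qed.

Lemma linopD x y x' y' : op_graph T (x, y) -> op_graph T (x', y') ->
  op_graph T (x + x', y + y').
Proof.
by move=> Txy /(linopZ (-1)); rewrite !scaleN1r => /(linopB _ _ _ _ Txy); rewrite !opprK.
Qed.

Lemma op_ran_subspace : linear_subspace (op_ran T).
Proof.
split=> [|a y y' [x xy] [x' xy']]; first by exists 0; exact: (op_graph0 T).
by exists (a *: x + x'); exact: op_graphP xy xy'.
Qed.

Lemma op_ker_subspace : linear_subspace (op_ker T).
Proof.
split=> [|a x x' xy xy']; first exact: (op_graph0 T).
rewrite /op_ker /=; have -> : (a *: x + x', 0) = a *: (x, 0 : Y) + (x', 0 : Y).
  by apply: pair_ext => //=; rewrite scaler0 addr0.
exact: op_graphP.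
Qed.
End LinOp.

Context {X Y : hilbertType R[i]} (T : linop X Y).
Hypotheses (Tclosed : closed_op T) (Tran : closed (op_ran T)).

(** The Baire half of the open mapping theorem: some set of images of a bounded ball is dense in a
    ball of [Y], and differences of its points approximate every small vector of the range. *)
Lemma approximate_lift : exists2 M : R, 0 < M &
  forall y, op_ran T y -> forall e, 0 < e -> exists x u,
    [/\ op_graph T (x, u), rnorm x <= M * rnorm y & rnorm (y - u) <= e].
Proof.
have sran := op_ran_subspace T.
(* Allowing a residue orthogonal to the range makes these sets cover all of [Y], so Baire applies to
   [Y] itself rather than to the range as a space of its own. *)
pose A n := [set y | exists x u, [/\ op_graph T (x, u), rnorm x <= n%:R &
   forall z, op_ran T z -> hdot (y - u) z = 0]].
have [|n [y0 [r [r0 Ar]]]] := baire_cover _ A.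
  move=> y; have [p [x xp] yp] := projection _ _ sran Tran y.
  by exists (Num.truncn (rnorm x)).+1, x, p; split=> //; apply/ltW/truncnS_gt.
(* A difference of two preimages has norm at most [2 * n%:R], and rescaling multiplies it by
   [2 * rnorm y / r]. The [+ 1] keeps the constant positive for [n = 0]. *)
have M0 : 0 < (4 * n%:R + 1) / r by rewrite divr_gt0// ltr_wpDl// mulr_ge0.
exists ((4 * n%:R + 1) / r) => // y Ty e e0.
have [->|yn0] := eqVneq y 0.
  exists 0, 0; split; first exact: (op_graph0 T).
    by rewrite !rnorm0 mulr0.
  by rewrite subrr rnorm0 ltW.
have y_gt0 := rnorm_gt0 _ _ yn0.
pose t := r / (2 * rnorm y).
have t0 : 0 < t by rewrite divr_gt0// mulr_gt0.
have ty : t * rnorm y = r / 2 by rewrite /t; field; rewrite gt_eqF.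
have d0 : 0 < t * e / 2 by rewrite divr_gt0// mulr_gt0.
have [|a1 [x1 [u1 [T1 x1n o1]]] ya1] := Ar (y0 + t%:C%C *: y) _ _ d0.
  by rewrite addrC addKr rnormZC gtr0_norm// ty; lra.
have [|a2 [x2 [u2 [T2 x2n o2]]] ya2] := Ar y0 _ _ d0.
  by rewrite subrr rnorm0.
have Txu := linopB _ _ _ _ _ T1 T2.
exists (t^-1%:C%C *: (x1 - x2)), (t^-1%:C%C *: (u1 - u2)).
have ti0 : 0 < t^-1 by rewrite invr_gt0.
split; first exact: linopZ.
- rewrite rnormZC gtr0_norm//.
  have -> : (4 * n%:R + 1) / r * rnorm y = t^-1 * ((4 * n%:R + 1) / 2).
    by rewrite /t invf_div; field; rewrite !gt_eqF.
  rewrite ler_pM2l//; have := rnormD _ x1 (- x2); rewrite rnormN.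
  have : 0 <= n%:R :> R by []. lra.
pose w := t%:C%C *: y - (u1 - u2).
have -> : y - t^-1%:C%C *: (u1 - u2) = t^-1%:C%C *: w.
  have tt : t^-1%:C%C * t%:C%C = 1 :> R[i] by rewrite -rmorphM /= mulVf// gt_eqF.
  by rewrite [RHS]scalerBr scalerA tt scale1r.
rewrite rnormZC gtr0_norm// -(ler_pM2l t0) mulrA divff ?gt_eqF// mul1r.
have Tw : op_ran T w.
  by apply: linear_subspaceB => //; [exact: linear_subspaceZ | exists (x1 - x2)].
(* The residues [a1 - u1] and [a2 - u2] are orthogonal to the range, which contains [w]; by
   Pythagoras, discarding them only improves the approximation. *)
have wo : hdot (u1 - u2 - (a1 - a2)) w = 0.
  have -> : u1 - u2 - (a1 - a2) = a2 - u2 - (a1 - u1).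
    by rewrite !opprB addrC addrACA [RHS]addrACA [- a1 - _]addrC.
  by rewrite hdotBl o1 ?o2 ?subrr.
apply: (@le_trans _ _ (rnorm (t%:C%C *: y - (a1 - a2)))).
  rewrite -ler_sqr ?nnegrE ?rnorm_ge0//.
  have -> : t%:C%C *: y - (a1 - a2) = w + (u1 - u2 - (a1 - a2)).
    by rewrite /w addrA subrK.
  by rewrite (pythagoras _ w _ (hdot_eq0C _ _ _ wo)) lerDl sqr_ge0.
rewrite [X in rnorm X](_ : _ = y0 + t%:C%C *: y - a1 - (y0 - a2)).
  apply: le_trans (rnormD _ _ _) _; rewrite rnormN; lra.
by rewrite !opprD !opprK -[y0 + _ - _]addrA [RHS]addrACA subrr add0r addrA.
Qed.

(** Lifting the remaining error again and again, halved each time, gives preimages that converge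
    geometrically; the closed graph makes the limit an exact preimage. *)
Lemma closed_range_lift : exists2 c : R, 0 < c &
  forall y, op_ran T y -> exists2 x, op_graph T (x, y) & rnorm x <= c * rnorm y.
Proof.
have [M M0 MP] := approximate_lift.
have sran := op_ran_subspace T.
exists (2 * M) => [|y Ty]; first by rewrite mulr_gt0.
have [->|yn0] := eqVneq y 0.
  by exists 0; [exact: (op_graph0 T) | rewrite !rnorm0 mulr0].
have y0 := rnorm_gt0 _ _ yn0.
(* [p = (k, (s, v))] with [T s = y - v] and [v] of norm at most [2^-k |y|] *)
have step (p : nat * (X * Y)) : exists q : X * Y, op_ran T p.2.2 ->
    [/\ op_ran T q.2, op_graph T (q.1 - p.2.1, p.2.2 - q.2),
        rnorm q.2 <= rnorm y * 2^-1 ^+ p.1.+1 &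
        rnorm (q.1 - p.2.1) <= M * rnorm p.2.2].
  case: p => k [s v] /=.
  have [Tv|] := pselect (op_ran T v); last by exists (s, v).
  have [|x [u [Txu xM vu]]] := MP v Tv (rnorm y * 2^-1 ^+ k.+1).
    by rewrite mulr_gt0// half_expn_gt0.
  exists (s + x, v - u) => _ /=; rewrite [s + x]addrC addrK subKr.
  by split=> //; apply: linear_subspaceB => //; exists x.
have [f fP] := choice step.
pose st := fix st n := if n is n'.+1 then f (n', st n') else (0 : X, y).
pose s n := (st n).1; pose v n := (st n).2.
have Tv n : op_ran T (v n) by elim: n => // n IH; case: (fP (n, st n) IH).
have stP n := fP (n, st n) (Tv n).
have vn n : rnorm (v n) <= rnorm y * 2^-1 ^+ n.
  by case: n => [|n]; [rewrite expr0 mulr1 | case: (stP n)].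
have Ts n : op_graph T (s n, y - v n).
  elim: n => [|n IH]; first by rewrite subrr; exact: (op_graph0 T).
  have [_ Tn _ _] := stP n; have := linopD _ _ _ _ _ IH Tn.
  by rewrite /= [X in op_graph T (X, _)]addrC subrK addrA subrK.
have [|l ls] := geometric_cvg _ s (M * rnorm y).
  move=> n; have [_ _ _ /le_trans] := stP n; apply.
  by rewrite -mulrA ler_pM2l//; exact: vn.
(* As [s 0 = 0], the rate of convergence at index 0 is the required bound on [l]. *)
exists l; last by have := ls 0%N; rewrite /s /= subr0 expr0 mulr1 mulrA.
move/closed_graphP : Tclosed; apply => e e0.
have [n ne] := half_expn_small ((2 * M + 1) * rnorm y) e e0.
have h0 := half_expn_gt0 n : 0 < 2^-1 ^+ n :> R.
have yh : 0 < rnorm y * 2^-1 ^+ n by rewrite mulr_gt0.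
have yM : 0 < M * (rnorm y * 2^-1 ^+ n) by rewrite mulr_gt0.
exists (s n), (y - v n); split=> //.
  apply: le_lt_trans (ls n) _; lra.
rewrite opprB addrC subrK; apply: le_lt_trans (vn n) _; lra.
Qed.

End OpenMapping.

(** * Semi-Fredholm property under lifting *)

Section Lipschitz.
Context {R : realType}.
Implicit Types U V W : normedModType R[i].

(** Differences are used so that the notion covers plain functions such as [ext_shift] and
    [finite_rank l], which carry no linear structure here. *)
Definition lipschitz_map {V W} (f : V -> W) :=
  exists2 M : R, 0 <= M & forall x y, rnorm (f x - f y) <= M * rnorm (x - y).

Lemma lipschitz_linear V W (f : {linear V -> W}) : continuous f -> lipschitz_map f.
Proof.
move=> /continuous_rnormP[M M0 fM]; exists M; first exact: ltW.
by move=> x y; rewrite -linearB.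
Qed.

Lemma lipschitz_comp U V W (g : V -> W) (f : U -> V) :
  lipschitz_map g -> lipschitz_map f -> lipschitz_map (g \o f).
Proof.
move=> [M M0 gM] [N N0 fN]; exists (M * N); first exact: mulr_ge0.
move=> x y; apply: le_trans (gM _ _) _.
by rewrite -mulrA ler_wpM2l.
Qed.

Lemma lipschitzD V W (f g : V -> W) :
  lipschitz_map f -> lipschitz_map g -> lipschitz_map (fun x => f x + g x).
Proof.
move=> [M M0 fM] [N N0 gN]; exists (M + N); first exact: addr_ge0.
move=> x y; rewrite opprD addrACA mulrDl.
by apply: le_trans (rnormD _ _ _) _; rewrite lerD.
Qed.

Lemma lipschitzZ V W a (f : V -> W) :
  lipschitz_map f -> lipschitz_map (fun x => a *: f x).
Proof.
move=> [M M0 fM]; exists (complex.Re `|a| * M).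
  by rewrite mulr_ge0// -ler0c RRe_real ?normr_real.
move=> x y; rewrite -scalerBr rnormZ -mulrA ler_wpM2l//.
by rewrite -ler0c RRe_real ?normr_real.
Qed.

Lemma lipschitzN V W (f : V -> W) :
  lipschitz_map f -> lipschitz_map (fun x => - f x).
Proof. by move=> [M M0 fM]; exists M => // x y; rewrite -opprD rnormN. Qed.

Lemma lipschitz_eq_dense V W (f g : V -> W) (A : set V) :
  lipschitz_map f -> lipschitz_map g -> dense A ->
  (forall x, A x -> f x = g x) -> f =1 g.
Proof.
move=> [M M0 fM] [N N0 gN] dA fg x.
apply: eq_from_rnorm => e e0.
have [d d0 de] := small_mul (M + N) e (addr_ge0 M0 N0) e0.
have [y Ay xy] := dense_rnorm _ _ dA x d d0.
apply: le_trans (ltW de); apply: le_trans (rnorm_tri _ (f y) _ _) _.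
have fgy : f y = g y := fg y Ay.
rewrite {2}fgy mulrDl lerD//.
  by apply: le_trans (fM _ _) _; rewrite ler_wpM2l// ltW.
by apply: le_trans (gN _ _) _; rewrite ler_wpM2l// rnormB ltW.
Qed.

Lemma lipschitz_near V W (f : V -> W) x (e : R) : lipschitz_map f -> 0 < e ->
  exists2 d, 0 < d & forall y, rnorm (x - y) < d -> rnorm (f x - f y) < e.
Proof.
move=> [M M0 fM] e0; have [d d0 de] := small_mul M e M0 e0.
exists d => // y xy; apply: le_lt_trans (fM _ _) (le_lt_trans _ de).
by rewrite ler_wpM2l// ltW.
Qed.
End Lipschitz.

(** * Transfer of the semi-Fredholm property along a finite-rank lift *)

Section SemiFredholm.
Context {R : realType}.

Definition finite_rank {V W : hilbertType R[i]} (l : seq (W * V)) (x : V) : W :=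
  \sum_(p <- l) hdot x p.2 *: p.1.

Lemma finite_rankP (V W : hilbertType R[i]) (l : seq (W * V)) a x y :
  finite_rank l (a *: x + y) = a *: finite_rank l x + finite_rank l y.
Proof.
rewrite /finite_rank scaler_sumr -big_split; apply: eq_bigr => p _ /=.
by rewrite hdotDl hdotZl scalerDl scalerA.
Qed.

Lemma lipschitz_finite_rank (V W : hilbertType R[i]) (l : seq (W * V)) :
  lipschitz_map (finite_rank l).
Proof.
elim: l => [|p l [M M0 lM]].
  exists 0 => // x y; rewrite /finite_rank !big_nil subrr rnorm0 mul0r//.
exists (rnorm p.2 * rnorm p.1 + M).
  by rewrite addr_ge0// mulr_ge0// rnorm_ge0.
move=> x y; rewrite /finite_rank !big_cons opprD addrACA mulrDl.
apply: le_trans (rnormD _ _ _) _; apply: lerD; last exact: lM.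
rewrite -scalerBl -hdotBl rnormZ mulrAC ler_wpM2r ?rnorm_ge0//.
by rewrite mulrC; exact: cauchy_schwarz.
Qed.

Lemma rnorm_hsum1 (V W : hilbertType R[i]) (z : hsum V W) : rnorm z.1 <= rnorm z.
Proof. by have := hsum_norm_ge1 z; rewrite !normE lecR. Qed.

Lemma rnorm_hsum2 (V W : hilbertType R[i]) (z : hsum V W) : rnorm z.2 <= rnorm z.
Proof. by have := hsum_norm_ge2 z; rewrite !normE lecR. Qed.

Lemma rnorm_hsum_le (V W : hilbertType R[i]) (z : hsum V W) :
  rnorm z <= rnorm z.1 + rnorm z.2.
Proof. by have := hsum_norm_le z; rewrite !normE -rmorphD lecR. Qed.

(** The maximum norm and the Hilbert norm are equivalent. Graphs are closed in the former, whereas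
    [closed_add_span] needs the latter. *)
Lemma closed_hsumP (V W : hilbertType R[i]) (G : set (V * W)) :
  closed G <-> closed (G : set (hsum V W)).
Proof.
split=> [/closed_graphP cG|/closed_rnormP cG].
  apply/closed_rnormP => -[x y] Gxy; apply: cG => e e0.
  have [[x' y'] G' xy] := Gxy e e0; exists x', y'; split=> //.
    exact: le_lt_trans (rnorm_hsum1 _ _ _) xy.
  exact: le_lt_trans (rnorm_hsum2 _ _ _) xy.
apply/closed_graphP => x y Gxy; apply: cG => e e0.
have [|x' [y' [G' xx yy]]] := Gxy (e / 2); first by rewrite divr_gt0.
exists (x', y') => //; apply: le_lt_trans (rnorm_hsum_le _ _ _) _.
by rewrite [e]splitr ltrD.
Qed.

Lemma linspan_map (V W : lmodType R[i]) (f : V -> W) (s : seq V) y :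
  (forall a u v, f (a *: u + v) = a *: f u + f v) ->
  linspan (map f s) y <-> exists2 x, linspan s x & y = f x.
Proof.
move=> fP; have f0 : f 0 = 0.
  by have := fP (-1) 0 0; rewrite scaler0 addr0 scaleN1r addNr.
elim: s y => [|v s IH] y /=.
  by split=> [->|[_ -> ->//]]; exists 0.
rewrite linspan_cons; split=> [[c /IH[x sx yx]]|[x [c sx] ->]].
  exists (c *: v + x); first by exists c; rewrite addrC addKr.
  by rewrite fP -yx addrC subrK.
exists c; apply/IH; exists (x - c *: v) => //.
by rewrite -!scaleNr [x + _]addrC fP addrC.
Qed.

(** Let [T x = y] and let [y'] in the range of [G] be close to [y]. A small lift [x''] of [y - y']
    makes [x - x''] a preimage of [y'], and [(x - x'', y')] lies in [G] because [G] contains the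
    kernel of [T]. Closedness of [G] then gives [(x, y)]. *)
Lemma closed_ran_restriction (X Y : hilbertType R[i]) (T : linop X Y)
    (G : set (X * Y)) :
  closed_op T -> closed (op_ran T) -> closed G -> linear_subspace G ->
  G `<=` op_graph T -> (forall x, op_ker T x -> G (x, 0)) -> closed (op_ran G).
Proof.
move=> cT rT /closed_graphP cG sG GT kG.
have [c c0 cP] := closed_range_lift _ cT rT.
apply/closed_rnormP => y yG.
have [x xy] : op_ran T y.
  move/closed_rnormP : rT; apply => e e0; have [y' [x' Gx'] yy] := yG e e0.
  by exists y' => //; exists x'; exact: GT.
exists x; apply: cG => e e0.
have [d d0 de] := small_mul c e (ltW c0) e0.
have [|y' [x' Gxy] yy] := yG (Num.min d e); first by rewrite lt_min d0.
move: yy; rewrite lt_min => /andP[yd ye].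
have [|x'' Tx'' x''y] := cP (y - y').
  by exists (x - x'); apply: linopB xy (GT _ Gxy).
exists (x - x''), y'; split=> //.
  have -> : (x - x'', y') = (x', y') + (x - x'' - x', 0).
    by apply: pair_ext => /=; rewrite ?addr0// [RHS]addrC subrK.
  apply: linear_subspaceD => //; apply: kG; rewrite /op_ker /=.
  rewrite -[0](subrr y') -{1}[y'](subKr y).
  by apply: linopB (GT _ Gxy); apply: linopB.
rewrite subKr; apply: le_lt_trans x''y (lt_trans _ de).
by rewrite ltr_pM2l.
Qed.

Lemma Fplus_of_lift (H1 H2 : hilbertType R[i])
    (T : linop (hsum H1 H2) (hsum H1 H2)) (S : linop H1 H1) (l : seq (H2 * H1)) :
  Fplus T -> closed_op S ->
  (forall f h, op_graph S (f, h) ->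
     exists g, op_graph T ((f, g), (h, finite_rank l f))) ->
  Fplus S.
Proof.
move=> [cT rT /fin_dimP[s Ts]] cS lift.
pose G0 : set (hsum (hsum H1 H2) (hsum H1 H2)) := [set p |
  [/\ op_graph T p, op_graph S (p.1.1, p.2.1) & p.2.2 = finite_rank l p.1.1]].
have sG0 : linear_subspace G0.
  split=> [|a u v [Tu Su lu] [Tv Sv lv]].
    split; [exact: op_graph0 | exact: (op_graph0 S) | apply/esym].
    by have := finite_rankP _ _ l (-1) 0 0; rewrite scaler0 addr0 scaleN1r addNr.
  split; [exact: op_graphP | exact: (op_graphP a Su Sv) |].
  by rewrite /= lu lv finite_rankP.
have cG0 : closed G0.
  move/closed_hsumP/closed_rnormP : cT => cT.
  move/closed_graphP : cS => cS.
  apply/closed_rnormP => p pG; split.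
  - by apply: cT => e e0; have [q [Tq _ _] pq] := pG e e0; exists q.
  - apply: cS => e e0; have [q [_ Sq _] pq] := pG e e0.
    exists q.1.1, q.2.1; split=> //.
      apply: le_lt_trans (rnorm_hsum1 _ _ (p.1 - q.1)) _.
      exact: le_lt_trans (rnorm_hsum1 _ _ (p - q)) pq.
    apply: le_lt_trans (rnorm_hsum1 _ _ (p.2 - q.2)) _.
    exact: le_lt_trans (rnorm_hsum2 _ _ (p - q)) pq.
  - apply: eq_from_rnorm => e e0.
    have e20 : 0 < e / 2 by rewrite divr_gt0.
    have [d d0 dK] := lipschitz_near _ _ _ p.1.1 _ (lipschitz_finite_rank _ _ l) e20.
    have [|q [_ _ lq] pq] := pG (Num.min d (e / 2)); first by rewrite lt_min d0.
    move: pq; rewrite lt_min => /andP[pd pe].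
    apply: le_trans (rnorm_tri _ q.2.2 _ _) _; rewrite [e]splitr lerD//.
      apply: le_trans (rnorm_hsum2 _ _ (p.2 - q.2)) _.
      exact: le_trans (rnorm_hsum2 _ _ (p - q)) (ltW pe).
    rewrite lq rnormB ltW// dK//.
    apply: le_lt_trans (rnorm_hsum1 _ _ (p.1 - q.1)) _.
    exact: le_lt_trans (rnorm_hsum1 _ _ (p - q)) pd.
pose i1 (z : hsum H1 H2) : hsum (hsum H1 H2) (hsum H1 H2) := (z, 0).
have i1P a u v : i1 (a *: u + v) = a *: i1 u + i1 v.
  by apply: pair_ext => //=; rewrite scaler0 addr0.
(* Adding the kernel of [T] in the first component leaves the range unchanged and meets the kernel
   condition of [closed_ran_restriction]. *)
pose G1 := add_span G0 (map i1 s).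
have G1P p : G1 p <-> exists2 z, op_ker T z & G0 (p - i1 z).
  rewrite /G1 add_spanP Ts.
  split=> [[q /(linspan_map _ _ _ _ _ i1P)[z sz ->] Gz]|[z sz Gz]].
    by exists z.
  by exists (i1 z) => //; apply/(linspan_map _ _ _ _ _ i1P); exists z.
have rG1 : closed (op_ran (G1 : set (hsum H1 H2 * hsum H1 H2))).
  apply: (closed_ran_restriction _ _ T) => //.
  - by apply/closed_hsumP; apply: closed_add_span.
  - exact: add_span_linear_subspace.
  - move=> p /G1P[z Tz [Tpz _ _]]; rewrite -[p](subrK (i1 z)).
    by move: (op_graphP 1 Tpz Tz); rewrite scale1r.
  - move=> z Tz; apply/G1P; exists z => //.
    by rewrite /i1 subrr; case: sG0.
have rG1P y : op_ran (G1 : set (hsum H1 H2 * hsum H1 H2)) y <->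
    exists2 f, op_graph S (f, y.1) & y.2 = finite_rank l f.
  split=> [[x /G1P[z _ [_ Sz lz]]]|[f Sf yf]].
    exists (x.1 - z.1).
      by move: Sz; rewrite /= subr0.
    by move: lz; rewrite /= subr0.
  have [g Tg] := lift _ _ Sf; exists (f, g); apply: sub_add_span; split => //=.
  by rewrite -yf in Tg; case: y yf Sf Tg.
pose i2 (v : H2) : hsum H1 H2 := (0, v).
have i2P a u v : i2 (a *: u + v) = a *: i2 u + i2 v.
  by apply: pair_ext => //=; rewrite scaler0 addr0.
have sranG1 : linear_subspace (op_ran (G1 : set (hsum H1 H2 * hsum H1 H2))).
  have [G10 G1A] := add_span_linear_subspace _ _ (map i1 s) sG0.
  split=> [|a u v [x xu] [y yv]]; first by exists 0.
  by exists (a *: x + y); exact: (G1A a _ _ xu yv).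
split=> //.
(* The second component is absorbed by the span of the vectors [p.1] of [l]: [h] is in the range of
   [S] exactly when [(h, 0)] is in the enlarged range. *)
- have /closed_rnormP cW := closed_add_span _ (map i2 (map fst l)) sranG1 rG1.
  apply/closed_rnormP => h hS.
  have : add_span (op_ran (G1 : set (hsum H1 H2 * hsum H1 H2)))
      (map i2 (map fst l)) (h, 0).
    apply: cW => e e0; have [h' [f Sf] hh] := hS e e0.
    exists (h', 0).
      apply/add_spanP; exists (i2 (- finite_rank l f)); last first.
        by apply/rG1P; exists f; rewrite /= ?subr0 ?sub0r ?opprK.
      apply/(linspan_map _ _ _ _ _ i2P); exists (- finite_rank l f) => //.
      rewrite -scaleN1r; apply: linear_subspaceZ; first exact: linspan_linear_subspace.
      rewrite /finite_rank; elim: (l) => [|p l' IH]; first by rewrite big_nil.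
      by rewrite big_cons /=; exists (hdot f p.2); rewrite addrC addKr.
    apply: le_lt_trans (rnorm_hsum_le _ _ _) _.
    by rewrite /= subrr rnorm0 addr0.
  move=> /add_spanP[q /(linspan_map _ _ _ _ _ i2P)[v _ ->]] /rG1P[f Sf _].
  by exists f; move: Sf; rewrite /= subr0.
(* Where all functionals of [l] vanish, the lift [(f, g)] is in the kernel of [T], so [f] is in the
   span of the first components of [s]. *)
have [|f Sf lf|t St] := linspan_of_forms (op_ker S) (map snd l) (map fst s).
- exact: op_ker_subspace.
- have [g Tg] := lift _ _ Sf.
  have K0 : finite_rank l f = 0.
    rewrite /finite_rank big_seq big1// => p pl.
    by rewrite lf ?scale0r//; exact: map_f.
  apply/linspan_map => //; exists (f, g) => //; rewrite -Ts /op_ker /=.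
  by rewrite K0 in Tg.
exact: linear_subspace_in_linspan (op_ker_subspace S) St.
Qed.
End SemiFredholm.

(** * Schur complements *)

Section GeneralisedInverse.
Context {R : realType}.

Lemma closed_op_shift (G : hilbertType R[i]) (T : linop G G) l :
  closed_op T -> closed_op (op_shift T l).
Proof.
move=> /closed_graphP cT; apply/closed_graphP => x y Txy.
apply: cT => e e0; pose c := complex.Re `|l|.
have c0 : 0 <= c by rewrite -ler0c RRe_real ?normr_real.
have [d d0 de] := small_mul (1 + c) e (addr_ge0 ler01 c0) e0.
have [|x' [y' [T' xx yy]]] := Txy (Num.min d e); first by rewrite lt_min d0.
move: xx yy; rewrite !lt_min => /andP[xd xe] /andP[yd ye].
exists x', (y' + l *: x'); split=> //.
apply: le_lt_trans de; rewrite opprD addrACA -scalerBr mulrDl mul1r.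
apply: le_trans (rnormD _ _ _) _; rewrite rnormZ lerD ?(ltW yd)//.
by rewrite ler_wpM2l// ltW.
Qed.

Lemma op_shift0 (G : hilbertType R[i]) (T : linop G G) :
  op_graph (op_shift T 0) = op_graph T.
Proof. by apply/seteqP; split=> -[x y]; rewrite /= /shift_graph /= scale0r addr0. Qed.

Lemma closed_op_ker (X Y : hilbertType R[i]) (T : linop X Y) :
  closed_op T -> closed (op_ker T).
Proof.
move=> /closed_graphP cT; apply/closed_rnormP => x xe.
apply: cT => e e0; have [x' Tx' xx] := xe e e0.
by exists x', 0; split=> //; rewrite subrr rnorm0.
Qed.

(** Subtracting from [x] its projection onto the closed kernel yields the value of the generalised
    inverse at [u]. *)
Lemma gen_inverse_exists (G : hilbertType R[i]) (T : linop G G) x u :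
  closed_op T -> op_graph T (x, u) ->
  exists2 y, op_graph T (y, u) & ortho_compl (op_ker T) y.
Proof.
move=> cT Tx.
have [k Tk xk] := projection _ _ (op_ker_subspace T) (closed_op_ker _ _ _ cT) x.
by exists (x - k) => //; rewrite -[u]subr0; exact: linopB.
Qed.

Lemma ran_coker_decomposition (X Y : hilbertType R[i]) (T : linop X Y) y :
  closed (op_ran T) ->
  exists p v, [/\ y = p + v, op_ran T p & op_coker T v].
Proof.
move=> rT; have [p Tp yp] := projection _ _ (op_ran_subspace T) rT y.
by exists p, (y - p); split=> //; rewrite addrC subrK.
Qed.
End GeneralisedInverse.

(** * Upper left corner of an operator on a direct sum *)

Section Compression.
Context {R : realType} {V W : hilbertType R[i]}.
Variable (F : {linear hsum V W -> hsum V W}).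

Definition compression (x : V) : V := (F (x, 0)).1.

Fact compression_linear : linear compression.
Proof.
move=> a x y; rewrite /compression.
have -> : (a *: x + y, 0) = a *: ((x, 0) : hsum V W) + (y, 0).
  by apply: pair_ext => //=; rewrite scaler0 addr0.
by rewrite linearP.
Qed.

HB.instance Definition _ :=
  GRing.isLinear.Build R[i] V V _ compression compression_linear.

Lemma compression_continuous : continuous F -> continuous compression.
Proof.
move=> /continuous_rnormP[M M0 FM].
apply/(@continuous_rnormP _ _ _ compression); exists M => // x.
apply: le_trans (rnorm_hsum1 _ _ _) _; apply: le_trans (FM _) _.
rewrite ler_pM2l//; apply: le_trans (rnorm_hsum_le _ _ _) _.
by rewrite /= rnorm0 addr0.
Qed.
End Compression.

(** * Comparison of the Schur complement with the block operator *)

Section SchurComplement.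
Context {R : realType} {H1 H2 DS D2 Dm1 Dm2 : hilbertType R[i]}.
Context (iS : embedding DS H1) (jS1 : embedding H1 Dm1).
Context (i2 : embedding D2 H2) (j2 : embedding H2 Dm2).
Context (A : {linear DS -> Dm1}) (B : {linear D2 -> Dm1}).
Context (C : {linear DS -> Dm2}) (D : {linear D2 -> Dm2}).
Context (D0 : linop H2 H2) (D' : {linear Dm2 -> D2}) (l : R[i]).
Hypothesis j2_dense : dense (range j2).
Hypothesis C_bounded : continuous C.
Hypothesis D0_closed : closed_op D0.
Hypothesis D_bounded : continuous D.
Hypothesis D_ext : forall g h, op_graph D0 (i2 g, h) -> D g = j2 h.
Hypothesis ran_closed : closed (op_ran (op_shift D0 l)).
Hypothesis D'_bounded : continuous D'.
Hypothesis D'_ext :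
  forall x y, gen_inverse (op_shift D0 l) (x, y) -> i2 (D' (j2 x)) = y.

Let T := op_shift D0 l.
Let S0 := part_op iS jS1 (schur_complement (emb_comp jS1 iS) A B C D' l).
Let A0 := part_op (emb_sum iS i2) (emb_sum jS1 j2) (block_op A B C D).

(* The extension [D - l] of [D0 - l], from [D2] to [Dm2]. *)
Definition ext_shift (g : D2) : Dm2 := D g - l *: j2 (i2 g).

Lemma ext_shiftN g : ext_shift (- g) = - ext_shift g.
Proof.
by rewrite /ext_shift (linearN D) (linearN i2) (linearN j2) scalerN opprD.
Qed.

Lemma lipschitz_ext_shift : lipschitz_map ext_shift.
Proof.
apply: lipschitzD; first exact: lipschitz_linear.
apply/lipschitzN/lipschitzZ.
apply: (@lipschitz_comp _ _ _ _ j2 i2); apply: lipschitz_linear.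
  exact: (@emb_continuous _ _ _ j2).
exact: (@emb_continuous _ _ _ i2).
Qed.

Lemma ext_shift_graph g h : op_graph T (i2 g, h) -> ext_shift g = j2 h.
Proof. by move=> /D_ext; rewrite /ext_shift => ->; rewrite linearD linearZ addrK. Qed.

(** On the image of [j2], [D'] acts as the generalised inverse of [T], and [T] after its generalised
    inverse is the projection onto the range. *)
Lemma ext_shift_inverse p v : op_ran T p -> op_coker T v ->
  ext_shift (D' (j2 (p + v))) = j2 p.
Proof.
move=> [x Tx] Tv.
have [y Ty yk] := gen_inverse_exists _ _ _ _ (closed_op_shift _ _ l D0_closed) Tx.
by apply: ext_shift_graph; rewrite (@D'_ext (p + v) y)//; exists p, v.
Qed.

(* [C - (D - l) D' C] vanishes when [D'] is a right inverse of [D - l]; in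
   general it takes values in [coker (D0 - l)] on a dense subspace, whence the
   finite-rank [K]. *)
Definition schur_defect (K : H1 -> H2) : Prop :=
  forall u, C u - ext_shift (D' (C u)) = j2 (K (iS u)).

Lemma S0_lift K f h : schur_defect K -> op_graph S0 (f, h) ->
  exists g, op_graph (op_shift A0 l) ((f, g), (h, K f)).
Proof.
(* Block elimination: this second component turns the first row into the Schur complement and the
   second row into the defect. *)
move=> defect [u /= -> Su]; exists (i2 (- D' (C u))).
exists (u, - D' (C u)) => //; apply: pair_ext => /=.
  rewrite linearD linearZ /= -Su /schur_complement /= linearN.
  by rewrite [RHS]addrAC subrK.
by rewrite (linearD j2) (linearZ_LR j2) /= -defect -ext_shiftN -addrA subrK.
Qed.

(** Without cokernel, [D'] is a right inverse of [ext_shift] on the dense range of [j2], hence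
    everywhere by continuity. *)
Lemma schur_defect0 : op_coker T = [set 0] -> schur_defect (finite_rank [::]).
Proof.
move=> coker0 u; rewrite /finite_rank big_nil linear0; apply/eqP.
rewrite subr_eq0; apply/eqP.
suff : id =1 ext_shift \o D' by move=> /(_ (C u)).
apply: (lipschitz_eq_dense _ _ _ _ (range j2)) => //.
- by exists 1 => // x y; rewrite mul1r.
- exact: lipschitz_comp lipschitz_ext_shift (lipschitz_linear _ _ _ D'_bounded).
move=> _ [x _ <-] /=.
have [p [v [-> Tp Tv]]] := ran_coker_decomposition _ _ T x ran_closed.
rewrite ext_shift_inverse//; move: Tv; rewrite coker0 => ->.
by rewrite addr0.
Qed.

(** For [C u = j2 x] the defect is the cokernel part of [x]. Expanding it in a dual family of the
    cokernel and moving [C0] to the other side by its adjoint gives functionals bounded on [H1];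
    density of the domain of [C0] in [DS] extends the identity to all [u]. *)
Lemma schur_defect_finite_rank (C0 := part_op iS j2 C) :
  fin_dim (op_coker T) -> op_coker T `<=` op_dom (adjoint C0) ->
  dense (iS @^-1` op_dom C0) -> exists K, schur_defect (finite_rank K).
Proof.
move=> /fin_dimP[s Ts] Tadj C0_dense.
have [K Ks Kx] := dual_family s.
have /choice[w wP] : forall q, exists w, op_coker T q -> adjoint C0 (q, w).
  move=> q; have [/Tadj[w qw]|] := pselect (op_coker T q); first by exists w.
  by exists 0.
exists [seq (p.1, w p.2) | p <- K].
apply: (lipschitz_eq_dense _ _ _ _ _ _ _ C0_dense).
- apply: lipschitzD; first exact: lipschitz_linear.
  apply: lipschitzN; apply: (lipschitz_comp _ _ _ (ext_shift \o D') C).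
    exact: lipschitz_comp lipschitz_ext_shift (lipschitz_linear _ _ _ D'_bounded).
  exact: lipschitz_linear.
- apply: (lipschitz_comp _ _ _ j2).
    exact/lipschitz_linear/(@emb_continuous _ _ _ j2).
  apply: (lipschitz_comp _ _ _ _ iS); first exact: lipschitz_finite_rank.
  exact/lipschitz_linear/(@emb_continuous _ _ _ iS).
move=> u [x C0u]; have [u' /= /emb_inj <- Cu] := C0u.
have [p [v [xpv Tp Tv]]] := ran_coker_decomposition _ _ T x ran_closed.
rewrite Cu {1 2}xpv ext_shift_inverse// linearD addrC addKr; congr (j2 _).
rewrite [LHS]Kx -?Ts// /finite_rank big_map !big_seq.
apply: eq_bigr => q /Ks[_]; rewrite -Ts => Tq /=; congr (_ *: _).
(* Since [q.2] is in the cokernel, pairing with it does not see the range part [p] of [x]. *)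
rewrite -(wP _ Tq _ _ C0u) xpv hdotDl.
suff -> : hdot p q.2 = 0 by rewrite add0r.
by apply: hdot_eq0C; exact: Tq.
Qed.

Lemma Fplus_S0 K : schur_defect (finite_rank K) -> closed_op S0 ->
  Fplus (op_shift A0 l) -> Fplus (op_shift S0 0).
Proof.
move=> defect cS0 FA0.
apply: (Fplus_of_lift _ _ _ _ K FA0) => [|f h].
  by rewrite /closed_op op_shift0.
by rewrite op_shift0; exact: S0_lift.
Qed.

Lemma resolvent_coker : resolvent D0 l -> op_coker T = [set 0].
Proof.
move=> [F _ FT]; apply/seteqP; split=> [v Tv|_ ->].
  by apply: hdot_self_eq0; apply: Tv; exists (F v); apply/FT.
by move=> y _; rewrite hdot0l.
Qed.

(** On the domain of [D0], kernel and cokernel of [T] are trivial and the generalised inverse is the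
    inverse; density in [D2] does the rest. *)
Lemma ext_shift_left_inverse : dense (i2 @^-1` op_dom D0) -> resolvent D0 l ->
  D' \o ext_shift =1 id.
Proof.
move=> D0_dense [F _ FT]; apply: (lipschitz_eq_dense _ _ _ _ _ _ _ D0_dense).
- exact: lipschitz_comp (lipschitz_linear _ _ _ D'_bounded) lipschitz_ext_shift.
- by exists 1 => // x y; rewrite mul1r.
move=> g [h gh] /=.
have Tg : op_graph T (i2 g, h - l *: i2 g) by rewrite /= /shift_graph /= subrK.
rewrite (ext_shift_graph _ _ Tg); apply: (@emb_inj _ _ _ i2).
apply: D'_ext; exists (h - l *: i2 g), 0; split=> //=; first by rewrite addr0.
  by move=> y _; rewrite hdot0l.
by move=> x /FT ->; rewrite linear0 hdot0r.
Qed.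

Lemma resolvent_S0 : dense (i2 @^-1` op_dom D0) ->
  resolvent D0 l -> resolvent A0 l -> resolvent S0 0.
Proof.
move=> D0_dense rD0 [F F_bounded FA0].
exists (compression F) => [|f h]; first exact: compression_continuous.
rewrite op_shift0; split=> [Sf|->].
  have [g Tg] := S0_lift _ _ _ (schur_defect0 (resolvent_coker rD0)) Sf.
  rewrite /finite_rank big_nil in Tg.
  by have /FA0/(congr1 fst) := Tg.
rewrite -[op_graph S0 _]/(op_graph S0 ((F (h, 0)).1, h)).
have : op_graph (op_shift A0 l) (F (h, 0), (h, 0)) by apply/FA0.
case: (F _) => f' g' [[u g]] /= [-> ->] [].
rewrite add0r (linearD jS1) (linearZ_LR jS1) (linearZ_LR j2) /= => Au Cu.
exists u => //=.
(* The second row reads [C u = - ext_shift g], and [D'] is a left inverse of [ext_shift].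
   Substituting in the first row leaves the Schur complement. *)
have DCu : D' (C u) = - g.
  rewrite -[g in RHS](ext_shift_left_inverse D0_dense rD0) /= -linearN /ext_shift.
  by rewrite -Cu opprB addrK.
by rewrite /schur_complement /= DCu linearN opprK addrAC Au addrK.
Qed.
End SchurComplement.

Theorem corollary3p6 (R : realType)
  (H1 H2 DS D2 DmS Dm1 Dm2 : hilbertType R[i])
  (iS : embedding DS H1) (jS : embedding H1 DmS) (kS : embedding DmS Dm1)
  (i2 : embedding D2 H2) (j2 : embedding H2 Dm2)
  (iS_dense : dense (range iS)) (jS_dense : dense (range jS))
  (i2_dense : dense (range i2)) (j2_dense : dense (range j2))
  (A : {linear DS -> Dm1}) (A_bounded : continuous A)
  (B : {linear D2 -> Dm1}) (B_bounded : continuous B)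
  (C : {linear DS -> Dm2}) (C_bounded : continuous C)
  (D0 : linop H2 H2) (D0_closed : closed_op D0)
  (D0_dom : op_dom D0 `<=` range i2)
  (D0_dense : dense (i2 @^-1` op_dom D0))
  (D : {linear D2 -> Dm2}) (D_bounded : continuous D)
  (D_ext : forall (g : D2) (h : H2), op_graph D0 (i2 g, h) -> D g = j2 h)
  (Theta : set R[i]) (D' : R[i] -> {linear Dm2 -> D2})
  (Theta_ran : forall l, Theta l -> closed (op_ran (op_shift D0 l)))
  (D'_bounded : forall l, Theta l -> continuous (D' l))
  (D'_ext : forall l, Theta l -> forall x y : H2,
     gen_inverse (op_shift D0 l) (x, y) -> i2 (D' l (j2 x)) = y) :
  let jS1 : embedding H1 Dm1 := emb_comp kS jS in
  let A0 : linop (hsum H1 H2) (hsum H1 H2) :=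
    part_op (emb_sum iS i2) (emb_sum jS1 j2) (block_op A B C D) in
  let S0 (l : R[i]) : linop H1 H1 :=
    part_op iS jS1 (schur_complement (emb_comp jS1 iS) A B C (D' l) l) in
  let C0 : linop H1 H2 := part_op iS j2 C in
  (family_spectrum Theta S0 `&` resolvent D0 `<=`
     spectrum A0 `&` resolvent D0 `&` Theta)
  /\
  (forall Sigma : set R[i], Sigma `<=` Theta ->
    (forall l, Sigma l ->
      closed_op (S0 l) /\
      (op_coker (op_shift D0 l) = [set 0] \/
       [/\ Fminus (op_shift D0 l),
           op_coker (op_shift D0 l) `<=` op_dom (adjoint C0) &
           dense (iS @^-1` op_dom C0)])) ->
    family_sigma_e2 Theta S0 `&` Sigma `<=` sigma_e2 A0 `&` Sigma).
Proof.
move=> jS1 A0 S0 C0; split=> [l [[Tl nS0] rD0]|Sigma SigmaT SigmaP l [[Tl nS0] Sl]].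
  split=> //; split=> // rA0; apply: nS0.
  exact: (resolvent_S0 _ _ _ _ _ _ _ _ _ _ _ j2_dense D0_closed D_bounded D_ext
    (Theta_ran l Tl) (D'_bounded l Tl) (D'_ext l Tl) D0_dense rD0 rA0).
split=> // FA0; apply: nS0.
have [cS0 cases] := SigmaP l Sl.
(* Both alternatives are brought to one form; a trivial cokernel corresponds to the empty list. *)
have [K defect] : exists K, schur_defect iS i2 j2 C D (D' l) l (finite_rank K).
  have [coker0|[[_ _ cfin] cadj C0_dense]] := cases.
    exists [::]; exact: (schur_defect0 _ _ _ _ _ _ _ _ j2_dense D0_closed D_bounded
      D_ext (Theta_ran l Tl) (D'_bounded l Tl) (D'_ext l Tl) coker0).
  exact: (schur_defect_finite_rank _ _ _ _ _ _ _ _ C_bounded D0_closed D_bounded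
    D_ext (Theta_ran l Tl) (D'_bounded l Tl) (D'_ext l Tl) cfin cadj C0_dense).
exact: Fplus_S0 defect cS0 FA0.
Qed.
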